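(* There exists a polynomial-time algorithm which, given a graph $G$ on $n$ vertices, an integer $k\geq 0$ and a number $c\geq 1$, terminates with exactly one of the following outcomes: (1) it correctly decides that $G$ does not admit a $(k,c)$-embedding into the line; (2) it computes a $(k',c')$-embedding of $G$ into the line with $k'=O(c^6 k\log^{5/2} n)$ and $c'=O(c^{13})$ (the $O(\cdot)$ hiding absolute constants).
   Context: All graphs are finite, undirected and unweighted; $d_\Gamma$ denotes the shortest-path metric of a graph $\Gamma$ (every edge has length $1$). For metric spaces $(X,\rho)$, $(X',\rho')$ and an injection $f:X\to X'$, the distortion of $f$ is $\sup_{x\neq y}\frac{\rho'(f(x),f(y))}{\rho(x,y)}\cdot\sup_{x\neq y}\frac{\rho(x,y)}{\rho'(f(x),f(y))}$; $f$ is a $c$-embedding if its distortion is at most $c$. The line is $(\mathbb{R},|\cdot|)$. A graph $\Gamma$ admits a $(k,c)$-embedding into the line if there exist $K\subseteq V(\Gamma)$ with $|K|\le k$ and an injective map $f:V(\Gamma)\setminus K\to\mathbb{R}$ whose distortion with respect to the metric $d_\Gamma$ restricted to $V(\Gamma)\setminus K$ is at most $c$ ($K$ is called an outlier set). *)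

(* Defs.v *)
From HB Require Import structures.
From mathcomp Require Import all_boot all_order all_algebra.
From mathcomp Require Import all_classical all_reals all_analysis.

Set Implicit Arguments.
Unset Strict Implicit.
Unset Printing Implicit Defensive.

Import Order.TTheory GRing.Theory Num.Theory.

Local Open Scope ring_scope.

(** * Graphs, shortest paths, and outlier embeddings into the line *)

(* A graph is a symmetric relation on a finite type; loops are harmless, as
   they do not affect distances. *)

Definition walk (T : finType) (e : rel T) (u v : T) (m : nat) : bool :=
  [exists p : m.-tuple T, path e u p && (last u p == v)].

(* A shortest path has fewer than #|T| edges, so the search succeeds exactly
   when u and v are connected; otherwise the value is the junk #|T|. *)
Definition dist (T : finType) (e : rel T) (u v : T) : nat :=
  find (walk e u v) (iota 0 #|T|).

(* The distortion of f restricted to X.  With sup set0 = 0, it is 0 when X has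
   at most one point. *)
Definition distortion (R : realType) (T U : Type) (X : set T)
    (rho : T -> T -> R) (rho' : U -> U -> R) (f : T -> U) : R :=
  sup [set r | exists x y, [/\ X x, X y, x <> y &
                 r = rho' (f x) (f y) / rho x y]]%classic *
  sup [set r | exists x y, [/\ X x, X y, x <> y &
                 r = rho x y / rho' (f x) (f y)]]%classic.

(* Only the values of f outside K matter.  Distances are those of the whole
   graph, not of the graph with K deleted.  The connectedness clause holds for
   every K when the graph is connected; in general it says that the distance
   is finite on the complement of K, hence a genuine metric there. *)
Definition outlier_embedding (R : realType) (T : finType) (e : rel T)
    (k c : R) (K : {set T}) (f : T -> R) : Prop :=
  [/\ #|K|%:R <= k,
      {in ~: K &, forall u v, connect e u v},
      {in ~: K &, injective f}
    & distortion [set u | u \notin K]%classic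
        (fun u v => (dist e u v)%:R) (fun x y : R => `|x - y|) f <= c].

Definition admits_outlier_embedding (R : realType) (T : finType) (e : rel T)
    (k c : R) : Prop :=
  exists (K : {set T}) (f : T -> R), outlier_embedding e k c K f.

(** * Random access machines with logarithmic cost *)

(* Structured programs over an unbounded memory of natural numbers with
   indirect addressing.  Evaluating any (sub)expression, including an address,
   costs the bit length of its value.  Under this logarithmic cost measure
   polynomial time is the same as for Turing machines. *)

Definition memory := nat -> nat.

Inductive expr : Type :=
| Const of nat
| Read of expr
| Add of expr & expr
| Sub of expr & expr
| Mul of expr & expr
| Div of expr & expr.

Inductive cmd : Type :=
| Skip
| Store of expr & expr
| Seq of cmd & cmd
| If of expr & cmd & cmd
| While of expr & cmd.

Fixpoint eval (M : memory) (x : expr) : nat :=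
  match x with
  | Const m => m
  | Read a => M (eval M a)
  | Add a b => (eval M a + eval M b)%N
  | Sub a b => (eval M a - eval M b)%N
  | Mul a b => (eval M a * eval M b)%N
  | Div a b => (eval M a %/ eval M b)%N
  end.

Definition bits (m : nat) : nat := (trunc_log 2 m).+1.

Fixpoint cost (M : memory) (x : expr) : nat :=
  (bits (eval M x) +
   match x with
   | Const _ => 0
   | Read a => cost M a
   | Add a b | Sub a b | Mul a b | Div a b => cost M a + cost M b
   end)%N.

Definition update (M : memory) (a m : nat) : memory :=
  fun b => if b == a then m else M b.

(* [exec p M t M'] : started on memory M, the program p halts after time t with
   memory M'.  A test succeeds when its value is nonzero. *)
Inductive exec : cmd -> memory -> nat -> memory -> Prop :=
| exec_skip M : exec Skip M 1 M
| exec_store a x M :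
    exec (Store a x) M (cost M a + cost M x) (update M (eval M a) (eval M x))
| exec_seq p q M t M' t' M'' :
    exec p M t M' -> exec q M' t' M'' -> exec (Seq p q) M (t + t') M''
| exec_if x p q M t M' :
    exec (if eval M x != 0%N then p else q) M t M' ->
    exec (If x p q) M (cost M x + t) M'
| exec_while_stop x p M :
    eval M x = 0%N -> exec (While x p) M (cost M x) M
| exec_while_loop x p M t M' t' M'' :
    eval M x <> 0%N -> exec p M t M' -> exec (While x p) M' t' M'' ->
    exec (While x p) M (cost M x + t + t') M''.

Lemma exec_det p M t1 M1 t2 M2 :
  exec p M t1 M1 -> exec p M t2 M2 -> t1 = t2 /\ M1 = M2.
Proof.
move=> E1; elim: E1 t2 M2 => {p M t1 M1}.
- by move=> M t2 M2 E; inversion E.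
- by move=> a x M t2 M2 E; inversion E.
- move=> p q M t M' t' M'' _ IHp _ IHq t2 M2 E.
  inversion E as [| |? ? ? ? ? ? ? Ep Eq| | |]; subst.
  by case: (IHp _ _ Ep) => ? ?; subst; case: (IHq _ _ Eq) => -> ->.
- move=> x p q M t M' _ IH t2 M2 E.
  inversion E as [| | |? ? ? ? ? ? Ei| |]; subst.
  by case: (IH _ _ Ei) => -> ->.
- by move=> x p M x0 t2 M2 E; inversion E.
- move=> x p M t M' t' M'' x0 _ IHp _ IHw t2 M2 E.
  inversion E as [| | | | |? ? ? ? ? ? ? ? Ep Ew]; subst => //.
  by case: (IHp _ _ Ep) => ? ?; subst; case: (IHw _ _ Ew) => -> ->.
Qed.

Definition memory_of (s : seq nat) : memory := nth 0%N s.

Definition bitsize (s : seq nat) : nat := sumn (map bits s).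

(** * Input and output conventions *)

(* n, k, the numerator and the denominator of c, then the adjacency matrix in
   row-major order. *)
Definition input (n : nat) (e : rel 'I_n) (k : nat) (c : rat) : seq nat :=
  [:: n; k; `|numq c|%N; `|denq c|%N] ++
  [seq nat_of_bool (e i j) | i <- enum 'I_n, j <- enum 'I_n].

(* Cell 0 holds 0 for a negative answer.  Otherwise the four cells from
   1 + 4 v hold a flag telling whether v is an outlier, followed by natural
   numbers a, b, d such that v is mapped to the rational (a - b) / d. *)
Definition says_no (M : memory) : bool := M 0%N == 0%N.

Definition output_outliers (n : nat) (M : memory) : {set 'I_n} :=
  [set v : 'I_n | M (1 + 4 * v)%N != 0%N]%SET.

Definition output_map (R : realType) (n : nat) (M : memory) (v : 'I_n) : R :=
  ((M (2 + 4 * v)%N)%:R - (M (3 + 4 * v)%N)%:R) / (M (4 + 4 * v)%N)%:R.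

(* Main.v *)
Require Import Defs.
From HB Require Import structures.
From mathcomp Require Import all_boot all_order all_algebra.
From mathcomp Require Import all_classical all_reals all_analysis.
From mathcomp Require Import zify lra ring.

Set Implicit Arguments.
Unset Strict Implicit.
Unset Printing Implicit Defensive.

Import Defs.
Import Order.TTheory GRing.Theory Num.Theory.

(* Let C be the integer ceiling of c.  Call vertices x, y, z asteroidal if each
   two of them are joined by a path that stays at distance more than C from the
   third one.  Let K be an outlier set with |K| <= k, f a C-embedding of its
   complement, and call y bad if a ball B(y, r) contains at least r / (2 (C + 1))
   vertices of K.  A Vitali covering argument bounds the number of bad vertices
   by 20 C^2 k.  If y is not bad and f x < f y < f z, then a path from x to z can
   only jump over y at a point within distance C of y, so that there is no
   asteroidal triple outside the union Q of K and the bad vertices.  Hence Q meets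
   every disconnected pair and every asteroidal triple, and contains half of
   every ball of radius 10 C that is too crowded for a C-embedding.

   The algorithm greedily deletes such obstacles.  It deletes at most 3 |Q|
   vertices, for otherwise the answer is negative.  If x, w are at maximal
   distance among the remaining vertices, the absence of asteroidal triples
   implies that d(x, u) and d(x, v) differ by d(u, v) up to an additive error
   10 C.  Scaling d(x, u) by the maximal size O(C^2) of a level of d(x, -) and
   adding the rank of u in its level yields an embedding of distortion
   O(C^3). *)

(** * Shortest paths *)

(** The outlier set and the embedding are unknown to the algorithm, which can only test conditions
    on the graph metric. The difficulty is that this is the metric of the whole graph: shortest
    paths may run through outliers, so near a cluster of [K] a path may leap over a vertex without
    coming close to it. Bad vertices are those for which such leaps are not excluded; discarding
    them is cheap because a map into the line that does not contract and is C-Lipschitz makes balls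
    grow linearly. The record [transversal] then forgets the map and keeps three conditions on
    distances and connectivity. Greedy deletion is a 3-approximation against any transversal:
    batches are disjoint and at least a third of each batch lies in it. The radius 10 C is the
    additive error of the coordinate d(x, -), hence a bound on the diameter of its levels; this is
    why the crowding test uses that radius. The bounds reached are 252 c^2 k and 7392 c^3; the
    powers of c and of log n in the theorem dominate them for c >= 1 and n >= 2. *)

Section Distance.
Variables (T : finType) (e : rel T).

Lemma walkP u v m :
  reflect (exists2 p, path e u p & last u p = v /\ size p = m) (walk e u v m).
Proof.
apply: (iffP existsP) => [[p /andP[ep /eqP lp]]|[p ep [lp sp]]].
  by exists p => //; rewrite size_tuple.
have sp' : size p == m by apply/eqP.
by exists (Tuple sp') => /=; rewrite ep lp eqxx.
Qed.

Lemma dist_le_card u v : dist e u v <= #|T|.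
Proof. by have := find_size (walk e u v) (iota 0 #|T|); rewrite size_iota. Qed.

Lemma dist_walk_lt u v : dist e u v < #|T| -> walk e u v (dist e u v).
Proof.
move=> lt; have /(nth_find 0) : has (walk e u v) (iota 0 #|T|).
  by rewrite has_find size_iota.
by rewrite nth_iota.
Qed.

Lemma walk_dist_le u v m : walk e u v m -> dist e u v <= m.
Proof.
move=> w; case: (leqP (dist e u v) m) => // lt.
have mT : m < #|T| := leq_trans lt (dist_le_card u v).
by have := before_find 0 lt; rewrite nth_iota // add0n w.
Qed.

(** A path shortened to distinct vertices has fewer than [#|T|] edges. The junk value of [dist] thus
    encodes disconnection exactly, and the programs test it in this form. *)
Lemma connect_dist u v : connect e u v = (dist e u v < #|T|).
Proof.
apply/connectP/idP => [[p ep ->]|/dist_walk_lt/walkP[p ep [<- _]]]; last first.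
  by exists p.
have [p' ep' up' _] := shortenP ep.
have w : walk e u (last u p') (size p') by apply/walkP; exists p'.
apply: leq_ltn_trans (walk_dist_le w) _.
by have := max_card (mem (u :: p')); rewrite (card_uniqP up').
Qed.

Lemma dist_walk u v : connect e u v -> walk e u v (dist e u v).
Proof. by rewrite connect_dist; apply: dist_walk_lt. Qed.

Lemma distxx u : dist e u u = 0.
Proof.
by apply/eqP; rewrite -leqn0; apply: walk_dist_le; apply/walkP; exists [::].
Qed.

Lemma dist_eq0 u v : dist e u v = 0 -> u = v.
Proof.
move=> d0; have : connect e u v.
  by rewrite connect_dist d0; apply/card_gt0P; exists u.
by move/dist_walk/walkP=> [p _ []]; rewrite d0 => <- /size0nil ->.
Qed.

Lemma dist_gt0 u v : u != v -> 0 < dist e u v.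
Proof. by move=> uv; rewrite lt0n; apply: contraNneq uv => /dist_eq0 ->. Qed.

Lemma walk_cat u v w a b : walk e u v a -> walk e v w b -> walk e u w (a + b).
Proof.
move=> /walkP[p ep [lp sp]] /walkP[q eq [lq sq]]; apply/walkP.
by exists (p ++ q); rewrite ?cat_path ?ep ?last_cat ?size_cat ?lp ?sp ?sq.
Qed.

(** No connectivity is assumed: the junk value [#|T|] is the largest value of [dist], so the
    inequality survives when a piece is disconnected. *)
Lemma dist_triangle v u w : dist e u w <= dist e u v + dist e v w.
Proof.
have [uv|uv] := boolP (connect e u v); last first.
  by move: uv (dist_le_card u w); rewrite connect_dist; lia.
have [vw|vw] := boolP (connect e v w); last first.
  by move: vw (dist_le_card u w); rewrite connect_dist; lia.
by apply: walk_dist_le; apply: walk_cat; apply: dist_walk.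
Qed.

Lemma dist_edge u v w : e v w -> dist e u w <= (dist e u v).+1.
Proof.
move=> evw; rewrite -addn1; apply: leq_trans (dist_triangle v u w) _.
by rewrite leq_add2l walk_dist_le //; apply/walkP; exists [:: w] => //=; rewrite evw.
Qed.

(** The bound [m.+1 < #|T|] excludes the junk value, so a shortest walk exists and its last edge can
    be removed. This is the induction step of Bellman-Ford. *)
Lemma dist_pred u v m : dist e u v = m.+1 -> m.+1 < #|T| ->
  exists2 w, dist e u w <= m & e w v.
Proof.
move=> uv mT; have : walk e u v m.+1 by rewrite -uv dist_walk_lt ?uv.
case/walkP=> p; case/lastP: p => [|p z] ep [lp] //.
rewrite size_rcons => -[sp]; move: ep lp; rewrite rcons_path last_rcons.
case/andP=> ep zv <-; exists (last u p) => //.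
by apply: walk_dist_le; apply/walkP; exists p.
Qed.

Hypothesis e_sym : symmetric e.

Lemma walk_sym u v m : walk e u v m = walk e v u m.
Proof.
suff imp x y : walk e x y m -> walk e y x m by apply/idP/idP; apply: imp.
move=> /walkP[p ep [<- sp]]; apply/walkP.
exists (rev (belast x p)).
  by rewrite rev_path; apply: sub_path ep => ? ?; rewrite e_sym.
rewrite size_rev size_belast; split=> //.
by case: (p) => //= a s; rewrite rev_cons last_rcons.
Qed.

Lemma dist_sym u v : dist e u v = dist e v u.
Proof. by apply: eq_find => m; rewrite walk_sym. Qed.

End Distance.

(** Indices in [nat] suit arguments about a last or first index; injectivity makes a run of indices
    count as many vertices. *)
Lemma connect_path_fun (T : finType) (e : rel T) (x z : T) :
  connect e x z -> exists (q : nat -> T) (l : nat),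
  [/\ q 0 = x, q l = z, forall i, i < l -> e (q i) (q i.+1)
    & forall i j, i <= l -> j <= l -> q i = q j -> i = j].
Proof.
case/connectP => p ep ->; have [p' ep' up' _] := shortenP ep.
exists (nth x (x :: p')), (size p'); split=> //.
- by rewrite (last_nth x).
- by move=> i /(pathP x ep').
move=> i j il jl; move/eqP; rewrite nth_uniq //=; by move/eqP.
Qed.

Lemma path_fun_dist (T : finType) (e : rel T) (q : nat -> T) l i m :
  (forall i, i < l -> e (q i) (q i.+1)) -> i + m <= l ->
  dist e (q i) (q (i + m)) <= m.
Proof.
move=> eq; elim: m => [|m IHm] im; first by rewrite addn0 distxx.
rewrite addnS; apply: leq_trans (dist_edge _ (eq _ _)) _; first lia.
by rewrite ltnS IHm //; lia.
Qed.

Lemma path_fun_connect (T : finType) (e : rel T) (q : nat -> T) l :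
  (forall i, i < l -> e (q i) (q i.+1)) -> connect e (q 0) (q l).
Proof.
elim: l => [|l IHl] eq; first exact: connect0.
apply: connect_trans (IHl _) (connect1 (eq _ _)) => // i il.
by apply: eq; lia.
Qed.

(** The pieces before, between and after two indices are no longer than their index lengths, and
    these add up to the distance; hence none is shorter. *)
Lemma geodesic (T : finType) (e : rel T) (x z : T) :
  connect e x z -> exists q : nat -> T,
  [/\ q 0 = x, q (dist e x z) = z,
      forall i, i < dist e x z -> e (q i) (q i.+1)
    & forall i m, i + m <= dist e x z -> dist e (q i) (q (i + m)) = m].
Proof.
move=> /dist_walk/walkP[p ep [lp sp]].
set q := nth x (x :: p); set l := dist e x z.
have eq i : i < l -> e (q i) (q i.+1) by rewrite /l -sp => /(pathP x ep).
have ql : q l = z by rewrite -lp (last_nth x) sp.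
exists q; split=> // i m iml; apply/eqP; rewrite eqn_leq (path_fun_dist eq) //=.
have d1 : dist e x (q i) <= i by apply: (path_fun_dist (i := 0) eq); lia.
have d2 : dist e (q (i + m)) z <= l - (i + m).
  by have := path_fun_dist (i := i + m) (m := l - (i + m)) eq; rewrite subnKC // ql; apply.
have := dist_triangle e (q i) x z; have := dist_triangle e (q (i + m)) (q i) z.
by rewrite -/l; lia.
Qed.

(** * Obstacles to an embedding into the line *)

Section Obstacles.
Variables (T : finType) (e : rel T) (C : nat).

Definition dball (u : T) (r : nat) : {set T} := [set v | dist e u v <= r]%SET.

Definition avoid (m : T) : rel T :=
  fun u v => [&& e u v, C < dist e m u & C < dist e m v].

(** Since [connect] is reflexive, the two distance conditions are needed when [x = z]; they also put
    the members of an asteroidal triple pairwise more than [C] apart. *)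
Definition avoids (m x z : T) : bool := 
  [&& C < dist e m x, C < dist e m z & connect (avoid m) x z].

(** A coarse version of the asteroidal triples of graph theory, which are the case [C = 1]. *)
Definition asteroidal (x y z : T) : bool :=
  [&& avoids x y z, avoids y x z & avoids z x y].

End Obstacles.

(** Measured from the leftmost image, all images fall into [L.+1] half-open unit intervals, and such
    an interval cannot hold two images at distance at least 1. *)
Lemma separated_card (R : realType) (T : finType) (S : {set T}) (g : T -> R)
    (L : nat) :
  {in S &, forall x y, x != y -> 1 <= `|g x - g y|}%R ->
  {in S &, forall x y, `|g x - g y| <= L%:R}%R -> #|S| <= L.+1.
Proof.
move=> sep bnd; have [->|[a0 a0S]] := set_0Vmem S; first by rewrite cards0.
case: (arg_minP g a0S) => a aS amin.
have rng x : x \in S -> (0 <= g x - g a <= L%:R)%R.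
  move=> xS; rewrite subr_ge0 (amin x xS) /=.
  exact: le_trans (ler_norm _) (bnd _ _ xS aS).
have tr x : x \in S -> ((Num.truncn (g x - g a))%:R <= g x - g a
    < (Num.truncn (g x - g a)).+1%:R)%R.
  by move=> /rng/andP[/truncn_itv].
pose F x : 'I_L.+1 := inord (Num.truncn (g x - g a)).
have vF x : x \in S -> F x = Num.truncn (g x - g a) :> nat.
  move=> xS; rewrite inordK //.
  have /andP[t1 _] := tr x xS; have /andP[_ t2] := rng x xS.
  by rewrite ltnS -(ler_nat R); apply: le_trans t1 t2.
rewrite -[L.+1]card_ord -(card_in_imset (f := F)) ?max_card // => x y xS yS Fxy.
apply/eqP/negP=> /negP /(sep x y xS yS).
have /andP[t1 t2] := tr x xS; have /andP[t3 t4] := tr y yS.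
move: t1 t2 t3 t4; rewrite -!vF // Fxy -natr1.
by case: (ler0P (g x - g y)%R) => _; lra.
Qed.

(** * Covering argument: counting the bad vertices *)

Section Vitali.
Variables (T : finType) (e : rel T).
Hypothesis e_sym : symmetric e.

(** Greedy choice of the largest radius: the ball of radius [2 * rho y] is removed from [S] and the
    ball of radius [rho y] from [K]. The former has at most [b * rho y] points, which are charged to
    the points of [K] in the latter. *)
Lemma vitali_card (X : {set T}) (rho : T -> nat) (a b : nat) :
  (forall u r, 0 < r -> #|X :&: dball e u (2 * r)| <= b * r) ->
  forall (S K : {set T}), (S \subset X)%SET ->
  {in S, forall y, 0 < rho y <= a * #|K :&: dball e y (rho y)|} ->
  #|S| <= a * b * #|K|.
Proof.
move=> dens S; move: {2}#|S|.+1 (ltnSn #|S|) => N.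
elim: N S => // N IHN S SN K SX rhoS.
have [->|[y0 y0S]] := set_0Vmem S; first by rewrite cards0.
case: (arg_maxnP rho y0S) => y yS ymax.
have /andP[ry yK] := rhoS _ yS.
pose S' := (S :\: dball e y (2 * rho y))%SET.
pose K' := (K :\: dball e y (rho y))%SET.
have S'K' : #|S'| <= a * b * #|K'|.
  apply: IHN.
  - rewrite -ltnS; apply: leq_trans SN; rewrite ltnS; apply: proper_card.
    apply/properP; split; first exact: subsetDl.
    by exists y => //; rewrite !inE distxx.
  - exact: fintype.subset_trans (subsetDl _ _) SX.
  (* A survivor [s] is farther than [2 * rho y >= rho y + rho s] from [y], so its ball misses
     everything removed from [K] and keeps its density. *)
  move=> s; rewrite !inE => /andP[sy sS]; have /andP[rs sK] := rhoS _ sS.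
  rewrite rs; apply: leq_trans sK _; rewrite leq_mul2l; apply/orP; right.
  apply: subset_leq_card; apply/fintype.subsetP=> v.
  rewrite !inE => /andP[vK sv]; rewrite vK sv andbT.
  have := ymax _ sS; have := dist_triangle e v y s.
  by rewrite (dist_sym e_sym v s); lia.
have Sy : #|S :&: dball e y (2 * rho y)| <= b * rho y.
  by apply: leq_trans (dens y _ ry); rewrite subset_leq_card // finset.setSI.
rewrite -(cardsID (dball e y (2 * rho y)) S) -(cardsID (dball e y (rho y)) K).
rewrite mulnDr; apply: leq_add S'K'; apply: leq_trans Sy _.
by rewrite (mulnC a) -mulnA leq_mul2l yK orbT.
Qed.
End Vitali.

Section Transversal.
Variables (R : realType) (T : finType) (e : rel T) (C : nat).
Variables (K : {set T}) (g : T -> R).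
Hypothesis e_sym : symmetric e.
Hypothesis g_exp :
  {in ~: K &, forall u v, (dist e u v)%:R <= `|g u - g v|}%SET%R.
Hypothesis g_lip :
  {in ~: K &, forall u v, `|g u - g v| <= C%:R * (dist e u v)%:R}%SET%R.

Lemma line_dball_card (u : T) (r : nat) : #|~: K :&: dball e u r| <= (2 * C * r).+1.
Proof.
apply: (separated_card (g := g)) => x y; rewrite !inE => /andP[xK ux] /andP[yK uy].
  move=> xy; apply: le_trans (g_exp _ _); rewrite ?inE //.
  by rewrite ler1n dist_gt0.
apply: le_trans (g_lip _ _) _; rewrite ?inE //.
rewrite -natrM ler_nat -mulnA mulnCA leq_mul2l; apply/orP; right.
by have := dist_triangle e u x y; rewrite (dist_sym e_sym x u); lia.
Qed.

(** The factor [C.+1] converts the length of a run in [K] into the radius of a ball about [y]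
    containing it; the factor 2 leaves only the empty run. *)
Definition sparse (y : T) : Prop :=
  forall r, 0 < r -> 2 * C.+1 * #|K :&: dball e y r| < r.

(* A path from x to z can jump over y only through a run of vertices of K that
   is at least as long, up to a factor C, as the distance from y; sparsity
   excludes nonempty runs. *)
Lemma sparse_between (x y z : T) :
  x \notin K -> y \notin K -> z \notin K -> sparse y ->
  (g x < g y < g z)%R -> ~~ avoids e C y x z.
Proof.
move=> xK yK zK ysp /andP[gxy gyz]; apply/negP=> /and3P[Cyx _].
case/connect_path_fun=> q [l [q0 ql qe qinj]].
have eq i : i < l -> e (q i) (q i.+1) by move/qe/and3P=> [].
have far i : i <= l -> C < dist e y (q i).
  by case: i => [|i] il; [rewrite q0|case/and3P: (qe _ il)].
(* [i] will be the last index outside [K] whose image is not to the right of [y], and [j] the next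
   index outside [K]. The path lies in [K] strictly between them, and [y] is mapped between their
   images. *)
pose P i := [&& i <= l, q i \notin K & (g (q i) <= g y)%R].
have P0 : P 0 by rewrite /P /= q0 xK ltW.
have Pl i : P i -> i <= l by case/and3P.
case: (ex_maxnP (ex_intro P 0 P0) Pl) => i /and3P[il qiK gqi] imax.
have i_lt : i < l.
  rewrite ltn_neqAle il andbT; apply: contraTneq gqi => ->.
  by rewrite ql -ltNge.
pose Q j := [&& i < j, j <= l & q j \notin K].
have Ql : Q l by rewrite /Q i_lt leqnn ql zK.
case: (ex_minnP (ex_intro Q l Ql)) => j /and3P[ij jl qjK] jmin.
have gqj : (g y < g (q j))%R.
  rewrite ltNge; apply/negP=> gqj.
  by have := imax j; rewrite /P jl qjK gqj => /(_ isT); rewrite leqNgt ij.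
have dij : dist e (q i) (q j) <= j - i.
  by have := path_fun_dist (i := i) (m := j - i) eq; rewrite subnKC ?(ltnW ij) //; apply.
have dyi : dist e y (q i) <= C * (j - i).
  rewrite -(ler_nat R); apply: le_trans (g_exp _ _) _; rewrite ?inE //.
  apply: (@le_trans _ _ (C%:R * (dist e (q i) (q j))%:R)%R); last first.
    by rewrite -natrM ler_nat leq_mul2l dij orbT.
  apply: le_trans _ (g_lip _ _); rewrite ?inE //.
  rewrite ger0_norm ?subr_ge0 // distrC ger0_norm ?subr_ge0 ?lerD2r ?(ltW gqj) //.
  exact: le_trans gqi (ltW gqj).
pose gap : {set T} := ([set q (i + t.+1) | t : 'I_(j - i).-1])%SET.
have gap_card : #|gap| = (j - i).-1.
  rewrite card_in_imset ?card_ord // => s t _ _ /qinj st; apply: val_inj => /=.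
  have in_l (r : 'I_(j - i).-1) : i + r.+1 <= l.
    by have := ltn_ord r; move: jl; clear; lia.
  by have /addnI[] := st (in_l s) (in_l t).
have gapK : (gap \subset K :&: dball e y (C.+1 * (j - i)))%SET.
  apply/fintype.subsetP=> v /imsetP[t _ ->]; have tij := ltn_ord t.
  have tj : i + t.+1 < j by move: tij; clear; lia.
  rewrite !inE; apply/andP; split.
    apply: contraT => qtK; have /negP[] : ~~ (j <= i + t.+1) by rewrite -ltnNge.
    apply: jmin; apply/and3P; split=> //; last exact: ltnW (leq_trans tj jl).
    by rewrite -[ltnLHS]addn0 ltn_add2l.
  have dt := path_fun_dist eq (ltnW (leq_trans tj jl)).
  apply: leq_trans (dist_triangle e (q i) y _) _.
  rewrite mulSn addnC; apply: leq_add (leq_trans dt _) dyi.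
  by move: tj; clear; lia.
have := ysp (C.+1 * (j - i)); have := subset_leq_card gapK.
rewrite gap_card => c1 /(_ _) c2.
(* The gap has [j - i - 1] vertices of [K], so sparsity gives [2 (j - i - 1) < j - i]. Hence
   [j - i = 1], and [dyi] puts [q i] within [C] of [y], against [far]. *)
have {}c2 : 2 * C.+1 * (j - i).-1 < C.+1 * (j - i).
  by apply: leq_ltn_trans (c2 _); rewrite ?leq_mul2l ?c1 ?orbT // muln_gt0 subn_gt0.
have ji : j - i = 1.
  by move: c2; rewrite -mulnA mulnCA ltn_mul2l /=; move: ij; clear; lia.
by have := far i il; move: dyi; rewrite ji muln1 leqNgt => /negP.
Qed.
End Transversal.

(** All that the algorithm needs from an embedding, with the map itself forgotten. Each field says
    that [Q] meets, or substantially fills, one kind of obstacle. *)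
Record transversal (T : finType) (e : rel T) (C : nat) (Q : {set T}) : Prop :=
  Transversal {
    transversal_connect : {in ~: Q &, forall u v, connect e u v}%SET;
    transversal_asteroidal :
      {in ~: Q & &, forall x y z, ~~ asteroidal e C x y z}%SET;
    transversal_dball : forall u r, #|~: Q :&: dball e u r| <= (2 * C * r).+1 }.

(** [Q] is [K] with the bad vertices added. The covering lemma with [a = 2 (C + 1)] and
    [b = 4 C + 1] yields at most [20 C^2 |K|] of them, as [C >= 1]; [K] itself accounts for the
    remaining unit in 21. *)
Lemma line_transversal (R : realType) (T : finType) (e : rel T) (C : nat)
    (K : {set T}) (g : T -> R) :
  symmetric e -> 0 < C ->
  {in ~: K &, forall u v, connect e u v}%SET ->
  {in ~: K &, forall u v, (dist e u v)%:R <= `|g u - g v|}%SET%R ->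
  {in ~: K &, forall u v, `|g u - g v| <= C%:R * (dist e u v)%:R}%SET%R ->
  exists2 Q : {set T}, #|Q| <= 21 * C ^ 2 * #|K| & transversal e C Q.
Proof.
move=> e_sym C_gt0 K_conn g_exp g_lip.
(* A radius witnessing badness is at most [2 * C.+1 * #|T|], so a finite range of radii suffices. *)
pose N := (2 * C.+1 * #|T|).+1.
pose bad_at y (r : 'I_N) := (0 < r) && (r <= 2 * C.+1 * #|K :&: dball e y r|).
pose bad := [set y in ~: K | [exists r, bad_at y r]]%SET.
pose rho y := if [pick r | bad_at y r] is Some r then val r else 0.
have badK : (bad \subset ~: K)%SET by apply/fintype.subsetP=> y; rewrite inE => /andP[].
have rhoP : {in bad, forall y, 0 < rho y <= 2 * C.+1 * #|K :&: dball e y (rho y)|}.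
  move=> y; rewrite inE => /andP[_ /existsP[r yr]]; rewrite /rho.
  by case: pickP => [r' //|/(_ r)]; rewrite yr.
have dens u r : 0 < r -> #|~: K :&: dball e u (2 * r)| <= (4 * C + 1) * r.
  move=> r0; apply: leq_trans (line_dball_card e_sym g_exp g_lip u _) _; nia.
have bad_card := vitali_card e_sym dens badK rhoP.
have sparseP y : y \notin (K :|: bad)%SET -> sparse e C K y.
  rewrite !inE negb_or negb_and => /andP[yK]; rewrite (negPf yK) /=.
  move/existsPn=> nbad r r_gt0; rewrite ltnNge; apply/negP=> rle.
  have rN : r < N.
    rewrite ltnS; apply: leq_trans rle _; rewrite leq_mul2l; apply/orP; right.
    exact: max_card.
  by have := nbad (Ordinal rN); rewrite /bad_at /= r_gt0 rle.
have sub : (~: (K :|: bad) \subset ~: K)%SET by rewrite finset.setCS finset.subsetUl.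
have between a m b : a \notin K -> m \notin (K :|: bad)%SET -> b \notin K ->
    (g a < g m < g b)%R || (g b < g m < g a)%R -> ~~ avoids e C m a b.
  move=> aK mQ bK; have mK : m \notin K by move: mQ; rewrite inE negb_or => /andP[].
  case/orP=> gamb.
    exact: (sparse_between g_exp g_lip aK mK bK (sparseP _ mQ) gamb).
  (* The reversed order is reduced to the first case by reflecting the line. *)
  apply: (@sparse_between R T e C K (fun v => - g v)%R) => //; last 1 first.
  - by rewrite !ltrN2 andbC.
  - by move=> u v uK vK /=; rewrite -opprD normrN; apply: g_exp.
  - by move=> u v uK vK /=; rewrite -opprD normrN; apply: g_lip.
  exact: sparseP.
exists (K :|: bad)%SET; last split.
- apply: leq_trans (leq_card_setU _ _) _; nia.
- by move=> u v /(fintype.subsetP sub) uK /(fintype.subsetP sub) vK; apply: K_conn.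
- have outQ v : v \in (~: (K :|: bad))%SET -> v \notin (K :|: bad)%SET by rewrite finset.in_setC.
  move=> x y z /outQ xQ /outQ yQ /outQ zQ.
  have inK v : v \notin (K :|: bad)%SET -> v \notin K by rewrite inE negb_or => /andP[].
  have gneq u v : u \notin (K :|: bad)%SET -> v \notin (K :|: bad)%SET ->
      C < dist e u v -> g u != g v.
    move=> /inK uK /inK vK Cuv; apply/eqP=> guv; have := g_exp u v.
    by rewrite !inE => /(_ uK vK); rewrite guv subrr normr0 lern0; lia.
  (* The three images are distinct because the vertices are far apart; whichever is in the middle
     belongs to a vertex that the other two cannot avoid. *)
  apply/negP=> /and3P[xyz yxz zxy].
  have /and3P[Cxy _ _] := xyz; have /and3P[Czx Czy _] := zxy.
  have := between _ _ _ (inK _ yQ) xQ (inK _ zQ); rewrite xyz.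
  have := between _ _ _ (inK _ xQ) yQ (inK _ zQ); rewrite yxz.
  have := between _ _ _ (inK _ xQ) zQ (inK _ yQ); rewrite zxy.
  have := gneq _ _ xQ yQ Cxy; have := gneq _ _ zQ xQ Czx; have := gneq _ _ zQ yQ Czy.
  case: (ltgtP (g x) (g y)); case: (ltgtP (g y) (g z)); case: (ltgtP (g x) (g z)) => //=;
  move=> _ _ _ _ _ _ i1 i2 i3; by [move: (i1 isT)|move: (i2 isT)|move: (i3 isT)].
move=> u r; apply: leq_trans (line_dball_card e_sym g_exp g_lip u r).
by rewrite subset_leq_card // finset.setSI.
Qed.

(** * Distortion expressed by two Lipschitz constants *)

Section Distortion.
Variables (R : realType) (T : finType) (e : rel T) (f : T -> R).
Local Open Scope ring_scope.

Lemma ratio_sup_ge (X : set T) (F : T -> T -> R) (x y : T) :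
  X x -> X y -> x <> y ->
  F x y <= sup [set r | exists x y, [/\ X x, X y, x <> y & r = F x y]]%classic.
Proof.
move=> Xx Xy xy; apply: ub_le_sup; last by exists x, y.
(* [sup] is meaningful only for bounded sets; finiteness of [T] supplies this crude bound. *)
exists (\sum_x \sum_y `|F x y|) => _ [u [v [_ _ _ ->]]].
rewrite (bigD1 u) //= (bigD1 v) //= -addrA.
apply: le_trans (ler_norm _) _; rewrite lerDl addr_ge0 //.
  by apply: sumr_ge0.
by apply: sumr_ge0 => i _; apply: sumr_ge0.
Qed.

(** The hypothesis [0 <= a] covers the absence of distinct pairs, where [sup] takes its default
    value 0. *)
Lemma ratio_sup_le (X : set T) (F : T -> T -> R) (a : R) :
  0 <= a -> (forall x y, X x -> X y -> x <> y -> F x y <= a) ->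
  sup [set r | exists x y, [/\ X x, X y, x <> y & r = F x y]]%classic <= a.
Proof.
move=> a0 Fa; set S := (X in sup X).
have [->|S0] := eqVneq S (@classical_sets.set0 R); first by rewrite sup0.
apply: ge_sup; first exact/set0P.
by move=> _ [x [y [Xx Xy xy ->]]]; apply: Fa.
Qed.

(** Distortion is invariant under scaling. Multiplying by [a], the Lipschitz constant of the
    inverse, makes the map noncontracting and moves the whole product [a * b <= c] into its
    Lipschitz constant. *)
Lemma outlier_embedding_scaled (k c : R) (K : {set T}) :
  outlier_embedding e k c K f -> exists g : T -> R,
  {in ~: K &, forall u v, (dist e u v)%:R <= `|g u - g v|}%SET /\
  {in ~: K &, forall u v, `|g u - g v| <= c * (dist e u v)%:R}%SET.
Proof.
case=> _ conn finj; rewrite /distortion.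
set X := [set u | u \notin K]%classic.
set b := sup _; set a := sup _ => abc.
have inX u : (u \in ~: K)%SET -> X u by rewrite inE.
have X_conn u v : X u -> X v -> u <> v -> 0 < (dist e u v)%:R :> R.
  by move=> _ _ /eqP uv; rewrite ltr0n dist_gt0.
have f_gt0 u v : X u -> X v -> u <> v -> 0 < `|f u - f v|.
  move=> uX vX uv; rewrite normr_gt0 subr_eq0; apply/eqP=> /finj.
  by rewrite !inE => /(_ uX vX).
have le_a u v : X u -> X v -> u <> v -> (dist e u v)%:R <= a * `|f u - f v|.
  move=> uX vX uv; rewrite -ler_pdivrMr ?f_gt0 //.
  exact: (ratio_sup_ge (fun u v => (dist e u v)%:R / `|f u - f v|)).
have le_b u v : X u -> X v -> u <> v -> `|f u - f v| <= b * (dist e u v)%:R.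
  move=> uX vX uv; rewrite -ler_pdivrMr ?X_conn //.
  exact: (ratio_sup_ge (fun u v => `|f u - f v| / (dist e u v)%:R)).
have a_ge0 u v : X u -> X v -> u <> v -> 0 <= a.
  move=> uX vX uv; rewrite -(pmulr_lge0 _ (f_gt0 _ _ uX vX uv)).
  by apply: le_trans (le_a _ _ uX vX uv); rewrite ler0n.
exists (fun u => a * f u); split=> u v /inX uX /inX vX.
  have [->|/eqP uv] := eqVneq u v; first by rewrite distxx.
  by rewrite -mulrBr normrM ger0_norm ?(a_ge0 u v) ?le_a.
have [->|/eqP uv] := eqVneq u v; first by rewrite distxx mulr0 subrr normr0.
rewrite -mulrBr normrM ger0_norm ?(a_ge0 u v) //.
apply: le_trans (ler_wpM2l (a_ge0 _ _ uX vX uv) (le_b _ _ uX vX uv)) _.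
by rewrite mulrA ler_wpM2r // mulrC.
Qed.

Lemma outlier_embedding_intro (k a b : R) (K : {set T}) :
  #|K|%:R <= k -> 0 <= a -> 0 <= b ->
  {in ~: K &, forall u v, connect e u v}%SET ->
  {in ~: K &, forall u v, `|f u - f v| <= a * (dist e u v)%:R}%SET ->
  {in ~: K &, forall u v, (dist e u v)%:R <= b * `|f u - f v|}%SET ->
  outlier_embedding e k (a * b) K f.
Proof.
move=> Kk a0 b0 conn fa fb; split=> //.
  move=> u v uK vK fuv; apply: (@dist_eq0 _ e); apply/eqP.
  by rewrite -leqn0 -(ler_nat R) (le_trans (fb _ _ uK vK)) // fuv subrr normr0 mulr0.
have inX u : u \notin K -> (u \in ~: K)%SET by rewrite inE.
rewrite /distortion; set s1 := sup _; set s2 := sup _.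
have s1a : s1 <= a.
  apply: ratio_sup_le => // u v /= /inX uK /inX vK /eqP uv.
  by rewrite ler_pdivrMr ?fa // ltr0n dist_gt0.
have s2b : s2 <= b.
  apply: ratio_sup_le => // u v /= /inX uK /inX vK /eqP uv.
  have d0 : 0 < b * `|f u - f v| by apply: lt_le_trans (fb _ _ uK vK); rewrite ltr0n dist_gt0.
  rewrite ler_pdivrMr ?fb // lt_def normr_ge0 andbT.
  by apply: contraTneq d0 => ->; rewrite mulr0 ltxx.
have s1_ge0 : 0 <= s1.
  have [[x [y [Xx Xy xy]]]|none] := pselect (exists x y : T, [/\ x \notin K, y \notin K & x <> y]).
    apply: le_trans (ratio_sup_ge (fun u v => `|f u - f v| / (dist e u v)%:R) Xx Xy xy).
    by rewrite divr_ge0.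
  rewrite /s1 (_ : [set r | _]%classic = classical_sets.set0) ?sup0 //.
  apply/seteqP; split=> r //= -[x [y [Xx Xy xy _]]]; exfalso.
  by apply: none; exists x, y.
by apply: le_trans (ler_wpM2l s1_ge0 s2b) _; rewrite ler_wpM2r.
Qed.

End Distortion.

(** * Distance from the end of a diametral pair as a coordinate *)

Section Coordinate.
Variables (T : finType) (e : rel T) (C : nat).
Hypothesis e_sym : symmetric e.

Local Notation d := (dist e).

(** If every vertex of the path were farther than [C] from [m], the path itself would be one of
    [avoid]. *)
Lemma geodesic_near (q : nat -> T) (l : nat) (m : T) :
  (forall i, i < l -> e (q i) (q i.+1)) -> ~~ avoids e C m (q 0) (q l) ->
  exists2 i, i <= l & d m (q i) <= C.
Proof.
move=> eq; apply: contraNP => none.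
have far i : i <= l -> C < d m (q i).
  by move=> il; rewrite ltnNge; apply/negP=> near; apply: none; exists i.
rewrite /avoids (far 0) // (far l) //=.
apply: path_fun_connect => i il.
by apply/and3P; split; [apply: eq|apply: far; lia|apply: far].
Qed.

(** Some vertex of a geodesic is within [C] of [m]; going to [m] and back costs [2 * C]. *)
Lemma dist_middle (m x z : T) :
  connect e x z -> ~~ avoids e C m x z -> d x m + d m z <= d x z + 2 * C.
Proof.
move=> /geodesic[q [q0 ql eq dq]] nav.
have [i il di] : exists2 i, i <= d x z & d m (q i) <= C.
  by apply: geodesic_near eq _; rewrite q0 ql.
have := dq 0 i il; have := dq i (d x z - i); rewrite add0n q0 subnKC // ql.
move=> /(_ (leqnn _)).
have := dist_triangle e (q i) x m; have := dist_triangle e (q i) m z.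
by rewrite (dist_sym e_sym (q i) m); lia.
Qed.

(** The order on one geodesic of the vertices near [m] and [m'] selects the alternative; each of the
    two detours costs [2 * C]. *)
Lemma dist_middle2 (m m' x z : T) :
  connect e x z -> ~~ avoids e C m x z -> ~~ avoids e C m' x z ->
  (d x m + d m m' + d m' z <= d x z + 4 * C) ||
  (d x m' + d m' m + d m z <= d x z + 4 * C).
Proof.
move=> /geodesic[q [q0 ql eq dq]] nav nav'.
have near a : ~~ avoids e C a x z -> exists2 i, i <= d x z & d a (q i) <= C.
  by move=> av; apply: geodesic_near eq _; rewrite q0 ql.
have [i il di] := near m nav; have [j jl dj] := near m' nav'.
have dx t : t <= d x z -> d x (q t) = t.
  by move=> tl; have := dq 0 t tl; rewrite add0n q0.
have dz t : t <= d x z -> d (q t) z = d x z - t.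
  by move=> tl; have := dq t (d x z - t); rewrite subnKC // ql; apply.
have := dx i il; have := dx j jl; have := dz i il; have := dz j jl.
have dij s t : s <= t -> t <= d x z -> d (q s) (q t) = t - s.
  by move=> st tl; have := dq s (t - s); rewrite subnKC //; apply.
have s1 := dist_sym e_sym (q i) m; have s2 := dist_sym e_sym (q j) m'.
have s3 := dist_sym e_sym m m'; have s4 := dist_sym e_sym (q i) (q j).
have t1 := dist_triangle e (q i) x m; have t2 := dist_triangle e (q i) m z.
have t3 := dist_triangle e (q j) x m'; have t4 := dist_triangle e (q j) m' z.
have t5 := dist_triangle e (q i) m m'; have t6 := dist_triangle e (q j) (q i) m'.
have [ij|ji] := leqP i j.
  have := dij i j ij jl; lia.
have := dij j i (ltnW ji) il; lia.
Qed.

(** If [y] or [z] is the middle vertex of [a], [y], [z], the error is at most 2 C. If [a] is,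
    comparison with [w] and maximality of [d a w] force [y] or [z] within 4 C of [a], and the error
    is at most 8 C. *)
Lemma dist_coordinate (A : {set T}) (a w : T) :
  {in A &, forall u v, connect e u v} ->
  {in A & &, forall x y z, ~~ asteroidal e C x y z} ->
  a \in A -> w \in A -> {in A &, forall u v, d u v <= d a w} ->
  {in A &, forall y z, d y z + minn (d a y) (d a z)
                        <= maxn (d a y) (d a z) + 10 * C}.
Proof.
move=> conn nast aA wA diam y z yA zA.
have mid x u v : x \in A -> u \in A -> v \in A ->
    [\/ ~~ avoids e C x u v /\ d u x + d x v <= d u v + 2 * C,
        ~~ avoids e C u x v /\ d x u + d u v <= d x v + 2 * C |
        ~~ avoids e C v x u /\ d x v + d v u <= d x u + 2 * C].
  move=> xA uA vA; have := nast x u v xA uA vA.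
  by case/nandP=> [n|/nandP[n|n]]; [apply: Or31|apply: Or32|apply: Or33];
    split=> //; apply: (dist_middle _ n); apply: conn.
have s := dist_sym e_sym.
have := s y a; have := s z a; have := s w a; have := s y w; have := s z w.
have := s y z.
have := diam _ _ aA yA; have := diam _ _ aA zA.
have := diam _ _ wA yA; have := diam _ _ wA zA.
have t1 := dist_triangle e a y z; have t2 := dist_triangle e w y z.
have t3 := dist_triangle e y a w; have t4 := dist_triangle e z a w.
case: (mid a y z aA yA zA) => [[na m1]|[_ m1]|[_ m1]]; try lia.
case: (mid a y w aA yA wA) => [[_ m2]|[_ m2]|[_ m2]]; try lia;
case: (mid a z w aA zA wA) => [[_ m3]|[_ m3]|[_ m3]]; try lia;
case: (mid w y z wA yA zA) => [[nw m4]|[_ m4]|[_ m4]]; try lia;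
(* Both [a] and [w] are now near a geodesic from [y] to [z], which is no longer than [d a w]; so [y]
   or [z] is within 4 C of [a]. *)
case/orP: (dist_middle2 (conn _ _ yA zA) na nw); lia.
Qed.

End Coordinate.

(** * Array programs with polynomial running time *)

Section Bounds.

Lemma bits_le m b : 0 < b -> m < 2 ^ b -> bits m <= b.
Proof.
move=> b0 mb; rewrite /bits; have [->|m0] := posnP m; first by rewrite trunc_log0.
have := trunc_logP (isT : 1 < 2) m0 => le2.
by rewrite -(ltn_exp2l _ _ (isT : 1 < 2)); apply: leq_ltn_trans mb.
Qed.

Lemma bits_lt m : m < 2 ^ bits m.
Proof. exact: trunc_log_ltn. Qed.

(** The exponent of [V] in a bound on the value, for memories bounded by [V >= 2]. A constant [m]
    gets degree [m] because [m < 2 ^ m]. *)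
Fixpoint degree (x : expr) : nat :=
  match x with
  | Const m => m
  | Read _ => 1
  | Add a b | Sub a b | Mul a b | Div a b => (degree a + degree b).+1
  end.

Fixpoint cost_factor (x : expr) : nat :=
  (degree x).+1 +
  match x with
  | Const m => 0
  | Read a => cost_factor a
  | Add a b | Sub a b | Mul a b | Div a b => cost_factor a + cost_factor b
  end.

Variables (M : memory) (V : nat).
Hypotheses (V_gt1 : 1 < V) (M_le : forall b, M b <= V).

Lemma eval_le x : eval M x <= V ^ degree x.
Proof.
have V0 : 0 < V by apply: ltn_trans V_gt1.
have mon a b : V ^ a <= V ^ (a + b).+1 by rewrite leq_exp2l //; lia.
elim: x => [m|a _|a IHa b IHb|a IHa b IHb|a IHa b IHb|a IHa b IHb] /=.
- by apply: ltnW; apply: ltn_expl.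
- by rewrite expn1.
- have ma := mon (degree a) (degree b); have mb := mon (degree b) (degree a).
  have -> : V ^ (degree a + degree b).+1 = V * (V ^ degree a * V ^ degree b).
    by rewrite expnS expnD.
  have : 0 < V ^ degree a by rewrite expn_gt0 V0.
  have : 0 < V ^ degree b by rewrite expn_gt0 V0.
  clear ma mb mon; move: (V ^ degree a) (V ^ degree b) IHa IHb => A B lA lB B0 A0.
  apply: leq_trans (leq_add lA lB) _.
  apply: (@leq_trans (2 * (A * B))); first nia.
  by rewrite leq_mul2r V_gt1 orbT.
- by apply: leq_trans (leq_subr _ _) _; apply: leq_trans (mon _ _).
- apply: leq_trans (leq_mul IHa IHb) _.
  by rewrite -expnD leq_exp2l.
- by apply: leq_trans (leq_div _ _) _; apply: leq_trans (mon _ _).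
Qed.

Lemma cost_le x : cost M x <= cost_factor x * bits V.
Proof.
have bx y : bits (eval M y) <= (degree y).+1 * bits V.
  apply: bits_le; first by rewrite muln_gt0.
  apply: leq_ltn_trans (eval_le y) _.
  apply: (@leq_ltn_trans ((2 ^ bits V) ^ degree y)).
    by case: (degree y) => // k; rewrite leq_exp2r // ltnW // bits_lt.
  by rewrite -expnM ltn_exp2l // mulSn mulnC -[X in X < _]add0n ltn_add2r.
elim: x => [m|y IHy|y IHy z IHz|y IHy z IHz|y IHy z IHz|y IHy z IHz].
- by have := bx (Const m); rewrite /= mulnDl; lia.
- by have := bx (Read y); rewrite /= mulnDl; lia.
- by have := bx (Add y z); rewrite /= !mulnDl; lia.
- by have := bx (Sub y z); rewrite /= !mulnDl; lia.
- by have := bx (Mul y z); rewrite /= !mulnDl; lia.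
- by have := bx (Div y z); rewrite /= !mulnDl; lia.
Qed.

End Bounds.

(* An array program acts on a low memory, which keeps the number n of vertices
   in cell 0 and the rest of the input or of the output in the cells up to
   4 + n^2, and on [narrays] unbounded arrays, interleaved in the cells above.
   It only stores values reduced modulo (n + 2)^2 and its loops range over
   0 .. n - 1, so that its running time is polynomial by construction. *)
Inductive aexpr : Type :=
| AConst of nat
| ALow of aexpr
| AArr of nat & aexpr
| AAdd of aexpr & aexpr
| ASub of aexpr & aexpr
| AMul of aexpr & aexpr
| ADiv of aexpr & aexpr.

Inductive acmd : Type :=
| ASkip
| AStore of nat & aexpr & aexpr
| AOut of aexpr & aexpr
| ASeq of acmd & acmd
| AIf of aexpr & acmd & acmd
| AFor of nat & acmd.

Definition astate : Type := (nat -> nat) * (nat -> nat -> nat).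

Section ArrayPrograms.

Implicit Types (s : astate) (x y : aexpr) (p q : acmd) (a : nat).

Definition dim s : nat := s.1 0.
(** The input fills [4 + n^2] cells, and the output ends at cell [4 n], which fits because
    [(n - 2)^2 >= 0]. *)
Definition low_max (n : nat) : nat := 4 + n * n.
(** Exceeds [n^2 + n], the largest value that a position can take, so the reductions do not alter
    the values the algorithm stores. *)
Definition cap (n : nat) : nat := n.+2 * n.+2.
Definition narrays : nat := 16.

Fixpoint aeval s x : nat :=
  match x with
  | AConst m => m
  | ALow y => s.1 (minn (aeval s y) (low_max (dim s)))
  | AArr a y => s.2 a (aeval s y)
  | AAdd y z => aeval s y + aeval s z
  | ASub y z => aeval s y - aeval s z
  | AMul y z => aeval s y * aeval s z
  | ADiv y z => aeval s y %/ aeval s z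
  end.

Definition set_arr s a i v : astate :=
  (s.1, fun b j => if (b == a) && (j == i) then v else s.2 b j).

Definition set_low s i v : astate := (update s.1 i v, s.2).

(** [AOut] cannot touch cell 0, so the dimension is constant during a run. A loop leaves its counter
    at [dim s], exactly as the compiled [While] does. *)
Fixpoint arun p s : astate :=
  match p with
  | ASkip => s
  | AStore a y x => set_arr s a (aeval s y) (aeval s x %% cap (dim s))
  | AOut y x =>
      if 0 < aeval s y <= low_max (dim s) then
        set_low s (aeval s y) (aeval s x %% cap (dim s))
      else s
  | ASeq p q => arun q (arun p s)
  | AIf x p q => if aeval s x != 0 then arun p s else arun q s
  | AFor a p =>
      set_arr (foldl (fun s i => arun p (set_arr s a 0 i)) s (iota 0 (dim s)))
        a 0 (dim s)
  end.

(** Required of loop bodies for their own counter: the compiled [While] reads it from memory,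
    whereas [arun] follows a fixed list of indices. *)
Fixpoint keeps a p : bool :=
  match p with
  | ASkip | AOut _ _ => true
  | AStore b _ _ => b != a
  | ASeq p q | AIf _ p q => keeps a p && keeps a q
  | AFor b p => (b != a) && keeps a p
  end.

Fixpoint wf_expr x : bool :=
  match x with
  | AConst _ => true
  | ALow y => wf_expr y
  | AArr a y => (a < narrays) && wf_expr y
  | AAdd y z | ASub y z | AMul y z | ADiv y z => wf_expr y && wf_expr z
  end.

Fixpoint wf p : bool :=
  match p with
  | ASkip => true
  | AStore a y x => [&& a < narrays, wf_expr y & wf_expr x]
  | AOut y x => wf_expr y && wf_expr x
  | ASeq p q => wf p && wf q
  | AIf x p q => [&& wf_expr x, wf p & wf q]
  | AFor a p => [&& a < narrays, keeps a p & wf p]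
  end.

Definition memory_of_state s : memory := fun b =>
  if b <= low_max (dim s) then s.1 b
  else s.2 ((b - (low_max (dim s)).+1) %% narrays)
           ((b - (low_max (dim s)).+1) %/ narrays).

Definition low_max_expr : expr :=
  Add (Const 4) (Mul (Read (Const 0)) (Read (Const 0))).
Definition cap_expr : expr :=
  let n2 := Add (Const 2) (Read (Const 0)) in Mul n2 n2.
Definition addr_expr a (x : expr) : expr :=
  Add (Add (Const 1) low_max_expr) (Add (Const a) (Mul (Const narrays) x)).
Definition mod_expr (x y : expr) : expr := Sub x (Mul (Div x y) y).

(** With truncated subtraction, [l - (l - y)] is the minimum of [y] and [l]; this is how [ALow] is
    clamped. *)
Fixpoint compile_expr x : expr :=
  match x with
  | AConst m => Const m
  | ALow y => Read (Sub low_max_expr (Sub low_max_expr (compile_expr y)))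
  | AArr a y => Read (addr_expr a (compile_expr y))
  | AAdd y z => Add (compile_expr y) (compile_expr z)
  | ASub y z => Sub (compile_expr y) (compile_expr z)
  | AMul y z => Mul (compile_expr y) (compile_expr z)
  | ADiv y z => Div (compile_expr y) (compile_expr z)
  end.

Fixpoint compile p : cmd :=
  match p with
  | ASkip => Skip
  | AStore a y x =>
      Store (addr_expr a (compile_expr y)) (mod_expr (compile_expr x) cap_expr)
  | AOut y x =>
      If (compile_expr y)
        (If (Sub (compile_expr y) low_max_expr) Skip
          (Store (compile_expr y) (mod_expr (compile_expr x) cap_expr)))
        Skip
  | ASeq p q => Seq (compile p) (compile q)
  | AIf x p q => If (compile_expr x) (compile p) (compile q)
  | AFor a p =>
      let i := addr_expr a (Const 0) in
      Seq (Store i (Const 0))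
        (While (Sub (Read (Const 0)) (Read i))
          (Seq (compile p) (Store i (Add (Read i) (Const 1)))))
  end.

Lemma arun_keeps a p s : keeps a p -> (arun p s).2 a = s.2 a.
Proof.
elim: p s => //= [b y x|y x|p IHp q IHq|x p IHp q IHq|b p IHp] s.
- by move=> ba; apply/funext => j; rewrite eq_sym (negPf ba).
- by case: ifP.
- by case/andP=> /IHp ap /IHq aq; rewrite aq ap.
- by case/andP=> /IHp ap /IHq aq; case: ifP.
case/andP=> ba /IHp ap; apply/funext => j; rewrite eq_sym (negPf ba) /=.
move: (iota 0 _) => r; elim: r s => //= i r IHr s; rewrite IHr ap /=.
by rewrite eq_sym (negPf ba).
Qed.

Lemma arun_dim p s : dim (arun p s) = dim s.
Proof.
elim: p s => //= [y x|p IHp q IHq|x p IHp q IHq|b p IHp] s.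
- by case: ifP => // /andP[y0 _]; rewrite /dim /= /update ltn_eqF.
- by rewrite IHq IHp.
- by case: ifP.
rewrite {1}/dim /= -/(dim _); move: (iota 0 _) => r; elim: r s => //= i r IHr s.
by rewrite IHr IHp.
Qed.

Lemma memory_of_state_low s b :
  b <= low_max (dim s) -> memory_of_state s b = s.1 b.
Proof. by rewrite /memory_of_state => ->. Qed.

Lemma memory_of_state_arr s a i : a < narrays ->
  memory_of_state s ((low_max (dim s)).+1 + (a + narrays * i)) = s.2 a i.
Proof.
move=> aN; rewrite /memory_of_state leqNgt ltnS leq_addr /= addKn.
by rewrite addnC mulnC modnMDl divnMDl // modn_small // divn_small // addn0.
Qed.

Lemma memory_of_set_low s i v : 0 < i <= low_max (dim s) ->
  memory_of_state (set_low s i v) = update (memory_of_state s) i v.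
Proof.
move=> /andP[i0 il]; have dims : dim (set_low s i v) = dim s.
  by rewrite /dim /= /update ltn_eqF.
apply/funext => b; rewrite /memory_of_state dims /= /update.
by case: (eqVneq b i) => [->|]; rewrite ?il //; case: ifP.
Qed.

Lemma memory_of_set_arr s a i v : a < narrays ->
  memory_of_state (set_arr s a i v)
  = update (memory_of_state s) ((low_max (dim s)).+1 + (a + narrays * i)) v.
Proof.
move=> aN; apply/funext => b; have dims : dim (set_arr s a i v) = dim s by [].
rewrite /update /memory_of_state dims /=.
set l := low_max _; have [bl|lb] := leqP b l; first by case: eqP => // ?; lia.
congr (if _ then _ else _); apply/andP/eqP => [[/eqP ra /eqP qi]|->].
  by have := divn_eq (b - l.+1) narrays; rewrite ra qi; lia.
by rewrite addKn addnC mulnC modnMDl divnMDl // modn_small // divn_small // addn0.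
Qed.

Lemma eval_dim s : memory_of_state s 0 = dim s.
Proof. by rewrite memory_of_state_low. Qed.

Lemma eval_low_max s : eval (memory_of_state s) low_max_expr = low_max (dim s).
Proof. by rewrite /= !eval_dim. Qed.

Lemma eval_cap s : eval (memory_of_state s) cap_expr = cap (dim s).
Proof. by rewrite /= !eval_dim !add2n. Qed.

Lemma eval_addr s a (x : expr) :
  eval (memory_of_state s) (addr_expr a x)
  = (low_max (dim s)).+1 + (a + narrays * eval (memory_of_state s) x).
Proof. by rewrite /= !eval_dim add1n. Qed.

Lemma eval_mod M (x y : expr) : eval M (mod_expr x y) = eval M x %% eval M y.
Proof. by rewrite /= {1}(divn_eq (eval M x) (eval M y)) addKn. Qed.

Lemma eval_compile s x :
  wf_expr x -> eval (memory_of_state s) (compile_expr x) = aeval s x.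
Proof.
elim: x => //= [y IHy|a y IHy|y IHy z IHz|y IHy z IHz|y IHy z IHz|y IHy z IHz].
- move=> /IHy ->; rewrite !eval_dim -/(low_max _) minnC minnE.
  by rewrite memory_of_state_low ?leq_subr.
- case/andP=> aN /IHy <-.
  by rewrite -[X in memory_of_state s X]/(eval _ (addr_expr a _)) eval_addr memory_of_state_arr.
- by case/andP=> /IHy -> /IHz ->.
- by case/andP=> /IHy -> /IHz ->.
- by case/andP=> /IHy -> /IHz ->.
- by case/andP=> /IHy -> /IHz ->.
Qed.

Fixpoint loop_depth p : nat :=
  match p with
  | ASkip | AStore _ _ _ | AOut _ _ => 0
  | ASeq p q | AIf _ p q => maxn (loop_depth p) (loop_depth q)
  | AFor _ p => (loop_depth p).+1
  end.

Fixpoint time_factor p : nat :=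
  match p with
  | ASkip => 1
  | AStore a y x =>
      cost_factor (addr_expr a (compile_expr y)) +
      cost_factor (mod_expr (compile_expr x) cap_expr)
  | AOut y x =>
      cost_factor (compile_expr y) +
      (cost_factor (Sub (compile_expr y) low_max_expr) +
       (cost_factor (compile_expr y) +
        cost_factor (mod_expr (compile_expr x) cap_expr) + 1))
  | ASeq p q => time_factor p + time_factor q
  | AIf x p q => cost_factor (compile_expr x) + (time_factor p + time_factor q)
  | AFor a p =>
      let i := addr_expr a (Const 0) in
      cost_factor i + cost_factor (Const 0) +
      (cost_factor (Sub (Read (Const 0)) (Read i)) +
       (time_factor p + (cost_factor i + cost_factor (Add (Read i) (Const 1)))))
  end.

Definition bounded (V : nat) s : Prop :=
  (forall b, s.1 b <= V) /\ (forall a i, s.2 a i <= V).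

Lemma bounded_memory V s : bounded V s -> forall b, memory_of_state s b <= V.
Proof. by move=> [s1 s2] b; rewrite /memory_of_state; case: ifP. Qed.

Lemma bounded_set_arr V s a i v : v <= V -> bounded V s -> bounded V (set_arr s a i v).
Proof. by move=> vV [s1 s2]; split=> //= b j; case: ifP. Qed.

Lemma bounded_set_low V s i v : v <= V -> bounded V s -> bounded V (set_low s i v).
Proof. by move=> vV [s1 s2]; split=> //= b; rewrite /update; case: ifP. Qed.

(** Stored values are residues modulo [cap] and counters never exceed the dimension, so the bound
    holds however long the run is. *)
Lemma bounded_arun V p s : 
  cap (dim s) <= V -> bounded V s -> bounded V (arun p s).
Proof.
move=> capV; have modV m : m %% cap (dim s) <= V.
  by apply: ltnW; apply: leq_trans capV; rewrite ltn_mod.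
have dimV m : m <= dim s -> m <= V.
  by move=> ms; apply: leq_trans capV; rewrite /cap; nia.
elim: p s capV modV dimV => //= [a y x|y x|p IHp q IHq|x p IHp q IHq|a p IHp] s capV modV dimV sV.
- exact: bounded_set_arr.
- by case: ifP => // _; apply: bounded_set_low.
- by apply: IHq; rewrite ?arun_dim //; apply: IHp.
- by case: ifP => _; [apply: IHp|apply: IHq].
apply: bounded_set_arr; first exact: dimV.
have : all (fun i => i <= dim s) (iota 0 (dim s)).
  by apply/allP=> i; rewrite mem_iota; lia.
move: (iota 0 _) => r; elim: r s capV modV dimV sV => //= i r IHr s capV modV dimV sV.
move=> /andP[il rl]; apply: IHr; rewrite ?arun_dim //.
by apply: IHp => //; apply: bounded_set_arr => //; apply: dimV.
Qed.

Local Arguments cost_factor : simpl never.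
Local Arguments cost : simpl never.

Lemma loop_time_le (x1 x2 x3 x4 x5 B n P : nat) : 0 < P ->
  x1 * B + x2 * B + (n * (x3 * B + (x5 * B * P + (x1 + x4) * B)) + x3 * B)
  <= (x1 + x2 + (x3 + (x5 + (x1 + x4)))) * B * (n.+1 * P).
Proof.
move=> P1; set S := (X in _ <= X * B * _).
have SP k : k <= S -> k * B <= S * B * P.
  by move=> kS; apply: leq_trans (leq_mul kS (leqnn B)) _; rewrite leq_pmulr.
have h1 : x1 * B + x2 * B + x3 * B <= S * B * P.
  by rewrite -!mulnDl SP // /S; lia.
have h2 : x3 * B + (x5 * B * P + (x1 + x4) * B) <= S * B * P.
  apply: (@leq_trans ((x3 + x5 + (x1 + x4)) * B * P)).
    by rewrite !mulnDl -addnA leq_add ?leq_add ?leq_pmulr.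
  by apply: leq_mul => //; apply: leq_mul => //; rewrite /S; lia.
have -> : S * B * (n.+1 * P) = n * (S * B * P) + S * B * P.
  by rewrite mulSn mulnDr addnC mulnCA.
by rewrite addnCA; apply: leq_add; first rewrite leq_mul2l h2 orbT.
Qed.

Section Compile.
Variable V : nat.
Hypothesis V_gt1 : 1 < V.

Let steps p s := time_factor p * bits V * (dim s).+1 ^ loop_depth p.

Lemma exec_compile p s : wf p -> cap (dim s) <= V -> bounded V s ->
  exists2 t, exec (compile p) (memory_of_state s) t (memory_of_state (arun p s))
           & t <= steps p s.
Proof.
have bV : 0 < bits V by [].
have costV s' (x : expr) : bounded V s' -> cost (memory_of_state s') x <= cost_factor x * bits V.
  by move=> bs; apply: cost_le => // b; apply: bounded_memory.
have exp_max n k l : n.+1 ^ k <= n.+1 ^ maxn k l by rewrite leq_pexp2l // leq_maxl.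
have exp_max' n k l : n.+1 ^ l <= n.+1 ^ maxn k l by rewrite leq_pexp2l // leq_maxr.
rewrite /steps.
elim: p s => [|a y x|y x|p IHp q IHq|x p IHp q IHq|a p IHp] s.
- by move=> *; exists 1; [exact: exec_skip|rewrite /= mul1n muln1].
- move=> /= /and3P[aN wy wx] capV sV.
  eexists.
    rewrite memory_of_set_arr // -eval_compile // -eval_compile // -eval_cap.
    rewrite -eval_mod -eval_addr; exact: exec_store.
  rewrite muln1 mulnDl; apply: leq_add; exact: costV.
- move=> /= /andP[wy wx] capV sV.
  set Y := compile_expr y; set X := mod_expr _ _.
  have eY : eval (memory_of_state s) Y = aeval s y by rewrite eval_compile.
  have eX : eval (memory_of_state s) X = aeval s x %% cap (dim s).
    by rewrite eval_mod eval_compile // eval_cap.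
  have eS : eval (memory_of_state s) (Sub Y low_max_expr) = aeval s y - low_max (dim s).
    by rewrite -eY -eval_low_max.
  have cY := costV s Y sV; have cX := costV s X sV.
  have cS := costV s (Sub Y low_max_expr) sV.
  case: ifPn => [/andP[y0 yl]|].
    eexists.
      apply: exec_if; rewrite eY -lt0n y0.
      apply: exec_if; rewrite eS (eqP yl) /=.
      rewrite memory_of_set_low ?y0 // -eX -eY; exact: exec_store.
    rewrite muln1; lia.
  rewrite negb_and -leqNgt -ltnNge leqn0; case: (eqVneq (aeval s y) 0) => [y0 _|y0 /= yl].
    eexists; first by apply: exec_if; rewrite eY y0 /=; apply: exec_skip.
    rewrite muln1; lia.
  eexists.
    apply: exec_if; rewrite eY y0; apply: exec_if.
    rewrite eS -lt0n subn_gt0 yl.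
    exact: exec_skip.
  rewrite muln1; lia.
- move=> /= /andP[wp wq] capV sV.
  have [t1 e1 l1] := IHp s wp capV sV.
  have [||t2 e2 l2] := IHq (arun p s) wq; rewrite ?arun_dim //; first exact: bounded_arun.
  exists (t1 + t2); first exact: exec_seq e1 e2.
  rewrite arun_dim in l2; apply: leq_trans (leq_add l1 l2) _.
  by rewrite mulnDl mulnDl leq_add // leq_mul2l ?exp_max ?exp_max' orbT.
- move=> /= /and3P[wx wp wq] capV sV.
  have cx := costV s (compile_expr x) sV.
  have [t e l] : exists2 t, exec (if eval (memory_of_state s) (compile_expr x) != 0 then compile p else compile q)
       (memory_of_state s) t (memory_of_state (if aeval s x != 0 then arun p s else arun q s))
     & t <= (time_factor p + time_factor q) * bits V * (dim s).+1 ^ maxn (loop_depth p) (loop_depth q).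
    rewrite eval_compile //; case: ifP => _.
      have [t e l] := IHp s wp capV sV; exists t => //; apply: leq_trans l _.
      by apply: leq_mul => //; rewrite leq_mul2r leq_addr orbT.
    have [t e l] := IHq s wq capV sV; exists t => //; apply: leq_trans l _.
    by apply: leq_mul => //; rewrite leq_mul2r leq_addl orbT.
  eexists; first exact: exec_if e.
  rewrite mulnDl mulnDl leq_add //; apply: leq_trans cx _.
  by rewrite leq_pmulr // expn_gt0.
move=> /= /and3P[aN ap wp] capV sV.
set i := addr_expr a (Const 0).
set n := dim s; set B := bits V.
set body := Seq _ (Store i _); set test := Sub _ _.
pose F s' j := arun p (set_arr s' a 0 j).
set c1 := cost_factor test * B.
set cb := time_factor p * B * n.+1 ^ loop_depth p
          + (cost_factor i + cost_factor (Add (Read i) (Const 1))) * B.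
have eI s' : eval (memory_of_state s') i = (low_max (dim s')).+1 + (a + narrays * 0).
  exact: eval_addr.
have rI s' : eval (memory_of_state s') (Read i) = s'.2 a 0.
  by rewrite /= -[X in memory_of_state _ X]/(eval (memory_of_state s') i) eI memory_of_state_arr.
have testE s' : eval (memory_of_state s') test = dim s' - s'.2 a 0.
  by rewrite -rI -eval_dim.
have fold_set s' j m : set_arr (foldl F (set_arr s' a 0 j) (iota j m)) a 0 n
    = set_arr (foldl F s' (iota j m)) a 0 n.
  have set_set s0 v w : set_arr (set_arr s0 a 0 v) a 0 w = set_arr s0 a 0 w.
    congr pair; apply/funext => b; apply/funext => k /=.
    by case: (_ && _).
  by case: m => [|m] /=; rewrite ?/F set_set.
(* The counter holds [j] and [m] rounds remain; the extra [c1] pays for the final failing test. *)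
have loop m j s' : j + m = n -> dim s' = n -> s'.2 a 0 = j -> bounded V s' ->
    exists2 t, exec (While test body) (memory_of_state s') t
      (memory_of_state (set_arr (foldl F s' (iota j m)) a 0 n))
    & t <= m * (c1 + cb) + c1.
  elim: m j s' => [|m IHm] j s' jm ds sj bs.
    exists (cost (memory_of_state s') test); last by rewrite mul0n add0n; apply: costV.
    rewrite /= (_ : set_arr s' a 0 n = s'); last first.
      case: s' sj {ds bs} => L A /= Aj; rewrite /set_arr /=; congr pair.
      apply/funext => b; apply/funext => k; case: ifP => // /andP[/eqP -> /eqP ->].
      by rewrite Aj -jm addn0.
    by apply: exec_while_stop; rewrite testE ds sj -jm addn0 subnn.
  have s'j : set_arr s' a 0 j = s'.
    case: s' sj {ds bs} => L A /= Aj; rewrite /set_arr /=; congr pair.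
    by apply/funext => b; apply/funext => k; case: ifP => // /andP[/eqP -> /eqP ->].
  have capV' : cap (dim s') <= V by rewrite ds.
  have [t1 e1 l1] := IHp s' wp capV' bs.
  set s1 := arun p s' in e1 *.
  have ds1 : dim s1 = n by rewrite arun_dim.
  have bs1 : bounded V s1 by apply: bounded_arun.
  have s1a : s1.2 a 0 = j by rewrite arun_keeps.
  pose s2 := set_arr s1 a 0 j.+1.
  have bs2 : bounded V s2.
    apply: bounded_set_arr => //; apply: leq_trans capV; rewrite /cap -/n; nia.
  have s2a : s2.2 a 0 = j.+1 by rewrite /= !eqxx.
  have jm2 : j.+1 + m = n by rewrite addSn -addnS.
  have [t2 e2 l2] := IHm j.+1 s2 jm2 ds1 s2a bs2.
  have e3 : exec (Store i (Add (Read i) (Const 1))) (memory_of_state s1)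
      (cost (memory_of_state s1) i + cost (memory_of_state s1) (Add (Read i) (Const 1)))
      (memory_of_state s2).
    rewrite memory_of_set_arr // -eI (_ : j.+1 = eval (memory_of_state s1) (Add (Read i) (Const 1))).
      exact: exec_store.
    by rewrite -[RHS]/(eval (memory_of_state s1) (Read i) + 1) rI s1a addn1.
  exists (cost (memory_of_state s') test +
      (t1 + (cost (memory_of_state s1) i + cost (memory_of_state s1) (Add (Read i) (Const 1)))) + t2).
    have Fs' : F s' j = s1 by rewrite /F s'j.
    rewrite [foldl _ _ _]/= Fs' -fold_set.
    apply: exec_while_loop e2; last exact: exec_seq e1 e3.
    by rewrite testE ds sj -jm; lia.
  rewrite ds in l1; rewrite mulSn -[leqRHS]addnA; apply: leq_add l2.
  have := costV s' test bs; have := costV s1 i bs1.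
  have := costV s1 (Add (Read i) (Const 1)) bs1.
  rewrite /c1 /cb -/B mulnDl; move: l1; rewrite -/B; lia.
have b0 : bounded V (set_arr s a 0 0) by apply: bounded_set_arr.
have a0 : (set_arr s a 0 0).2 a 0 = 0 by rewrite /= !eqxx.
have [t e l] := loop n 0 _ (add0n n) (erefl : dim (set_arr s a 0 0) = n) a0 b0.
exists (cost (memory_of_state s) i + cost (memory_of_state s) (Const 0) + t).
  rewrite -/F -/n -fold_set; apply: exec_seq e.
  rewrite memory_of_set_arr // -eI; exact: exec_store.
have ci := costV s i sV; have c0 := costV s (Const 0) sV.
apply: leq_trans (leq_add (leq_add ci c0) l) _; rewrite /cb /c1.
by rewrite expnS; apply: loop_time_le; rewrite expn_gt0.
Qed.

End Compile.

(** * Rules for loops *)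

Definition agree (l : seq nat) s s' : Prop :=
  s'.1 = s.1 /\ forall b, b \notin l -> s'.2 b = s.2 b.

Lemma agree_trans l s1 s2 s3 : agree l s1 s2 -> agree l s2 s3 -> agree l s1 s3.
Proof. by move=> [e12 a12] [e23 a23]; split=> [|b bl]; rewrite ?e23 ?a23 ?a12. Qed.

Lemma agree_set_arr (l : seq nat) s a i v : a \in l -> agree l s (set_arr s a i v).
Proof.
move=> al; split=> // b bl; apply/funext => j /=.
by case: eqP bl => // ->; rewrite al.
Qed.

Lemma agree_dim l s s' : agree l s s' -> dim s' = dim s.
Proof. by rewrite /dim => -[->]. Qed.

Lemma agree_arr l s s' b : agree l s s' -> b \notin l -> s'.2 b = s.2 b.
Proof. by case=> _; apply. Qed.

Lemma agree_sub (l l' : seq nat) s s' : {subset l <= l'} -> agree l s s' -> agree l' s s'.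
Proof. by move=> ll [e al]; split=> // b bl; apply: al; apply: contra bl; apply: ll. Qed.

(** The invariant has to tolerate writes to the counter, since they open every round and close the
    loop. *)
Lemma arun_for n (I : nat -> astate -> Prop) a p s :
  dim s = n -> I 0 s ->
  (forall i s', I i s' -> forall j, I i (set_arr s' a 0 j)) ->
  (forall (i : 'I_n) s', I i s' -> s'.2 a 0 = i -> I i.+1 (arun p s')) ->
  I n (arun (AFor a p) s).
Proof.
move=> dn I0 Iset Istep /=; rewrite dn; apply: (Iset).
have loop k j s' : j + k = n -> I j s' ->
    I n (foldl (fun s i => arun p (set_arr s a 0 i)) s' (iota j k)).
  elim: k j s' => [|k IHk] j s' /= jk Ij; first by rewrite -jk addn0.
  apply: IHk; first lia.
  have jn : j < n by lia.
  by apply: (Istep (Ordinal jn)); [apply: Iset|rewrite /= !eqxx].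
exact: loop.
Qed.

(* Rounds make progress in the preorder [Rel], under which the properties [G i]
   that they establish are stable. *)
Lemma arun_pass n (Rel : astate -> astate -> Prop) (G : 'I_n -> astate -> Prop) a p s :
  dim s = n -> (forall s1, Rel s1 s1) ->
  (forall s1 s2 s3, Rel s1 s2 -> Rel s2 s3 -> Rel s1 s3) ->
  (forall s1 j, Rel s1 (set_arr s1 a 0 j)) ->
  (forall i s1 s2, Rel s1 s2 -> G i s1 -> G i s2) ->
  (forall (i : 'I_n) s', Rel s s' -> s'.2 a 0 = i ->
     (forall b, b != a -> keeps b p -> s'.2 b = s.2 b) ->
     (forall j : 'I_n, j < i -> G j s') ->
     Rel s' (arun p s') /\ G i (arun p s')) ->
  Rel s (arun (AFor a p) s) /\ forall i, G i (arun (AFor a p) s).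
Proof.
move=> dn Rrefl Rtrans Rset Gst step.
pose I k s' := [/\ Rel s s', (forall b, b != a -> keeps b p -> s'.2 b = s.2 b)
                 & forall j : 'I_n, j < k -> G j s'].
suff [Rs _ Gs] : I n (arun (AFor a p) s) by split=> // i; apply: Gs.
apply: arun_for => //.
- move=> k s' [Rs Ks Gs] j; split.
  + exact: Rtrans Rs _.
  + move=> b ba kb; rewrite -Ks //; apply: (agree_arr (l := [:: a])).
      by apply: agree_set_arr; rewrite inE.
    by rewrite inE.
  + by move=> i ik; apply: Gst (Gs i ik).
move=> i s' [Rs Ks Gs] ai; have [R' G'] := step i s' Rs ai Ks Gs.
split; first exact: Rtrans R'.
  by move=> b ba kb; rewrite arun_keeps ?Ks.
move=> j; rewrite ltnS leq_eqVlt => /orP[/eqP/val_inj ->//|ji].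
exact: Gst R' (Gs j ji).
Qed.

Lemma ltn_cap m n : m <= n -> m < cap n.
Proof. by rewrite /cap; nia. Qed.

Lemma set_arrE s a j v b i :
  (set_arr s a j v).2 b i = if (b == a) && (i == j) then v else s.2 b i.
Proof. by []. Qed.

Definition var a : aexpr := AArr a (AConst 0).
Definition size_expr : aexpr := ALow (AConst 0).
Definition lt_expr x y : aexpr := ASub y x.
Definition le_expr x y : aexpr := ASub (AAdd y (AConst 1)) x.
Definition not_expr x : aexpr := ASub (AConst 1) x.

Definition holds s x : bool := aeval s x != 0.

Lemma aeval_size s : aeval s size_expr = dim s.
Proof. by rewrite /= min0n. Qed.

Lemma holds_lt s x y : holds s (lt_expr x y) = (aeval s x < aeval s y).
Proof. by rewrite /holds /= -lt0n subn_gt0. Qed.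

Lemma holds_le s x y : holds s (le_expr x y) = (aeval s x <= aeval s y).
Proof. by rewrite /holds /= -lt0n subn_gt0 addn1 ltnS. Qed.

Lemma holds_not s x : holds s (not_expr x) = ~~ holds s x.
Proof. by rewrite /holds /=; case: (aeval s x). Qed.

Lemma holds_and s x y : holds s (AMul x y) = holds s x && holds s y.
Proof. by rewrite /holds /= muln_eq0 negb_or. Qed.

Definition holdsE := (holds_lt, holds_le, holds_not, holds_and).

Definition count_cmd a b x : acmd :=
  ASeq (AStore a (AConst 0) (AConst 0))
    (AFor b (AIf x (AStore a (AConst 0) (AAdd (var a) (AConst 1))) ASkip)).

Lemma arun_count n a b x s (P : pred 'I_n) :
  dim s = n -> a != b ->
  (forall (i : 'I_n) s', agree [:: a; b] s s' -> s'.2 b 0 = i -> holds s' x = P i) ->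
  agree [:: a; b] s (arun (count_cmd a b x) s) /\
  (arun (count_cmd a b x) s).2 a 0 = #|P|.
Proof.
move=> dn ab xP; pose s0 := set_arr s a 0 (0 %% cap (dim s)).
pose body := AIf x (AStore a (AConst 0) (AAdd (var a) (AConst 1))) ASkip.
rewrite -[arun (count_cmd _ _ _) s]/(arun (AFor b body) s0).
have ags0 : agree [:: a; b] s s0 by apply: agree_set_arr; rewrite !inE eqxx.
pose I k s' := agree [:: a; b] s s' /\ s'.2 a 0 = #|[set i : 'I_n | P i & i < k]%SET|.
suff [? ->] : I n (arun (AFor b body) s0).
  by split=> //; apply: eq_card => i; rewrite inE ltn_ord andbT.
apply: arun_for.
- exact: dn.
- split=> //; rewrite /s0 set_arrE !eqxx mod0n; apply/esym/eqP.
  by rewrite cards_eq0; apply/eqP/setP => i; rewrite !inE andbF.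
- move=> k s' [ag c] j; split.
    by apply: agree_trans ag (agree_set_arr _ _ _ _); rewrite !inE eqxx orbT.
  by rewrite set_arrE (negPf ab).
move=> i s' [ag c] bi; have := xP i s' ag bi; rewrite /= -/(holds s' x) => ->.
have split_i : #|[set j : 'I_n | P j & j < i.+1]%SET|
     = P i + #|[set j : 'I_n | P j & j < i]%SET|.
  rewrite (cardsD1 i) !inE ltnSn andbT; congr (_ + _); apply: eq_card => j.
  rewrite !inE ltnS leq_eqVlt; case: (eqVneq j i) => [->|ji] /=.
    by rewrite ltnn andbF.
  by rewrite (_ : (j == i :> nat) = false) //; apply: negPf; apply: contra ji => /eqP/val_inj ->.
case Pi : (P i); last by split; rewrite // c split_i Pi.
have cn : s'.2 a 0 < n.
  rewrite c -[X in _ < X]card_ord -cardsT proper_card //; apply/properP.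
  by split; [apply/fintype.subsetP=> j; rewrite !inE|exists i; rewrite !inE ?ltnn ?andbF].
split; first by apply: agree_trans ag (agree_set_arr _ _ _ _); rewrite !inE eqxx.
rewrite set_arrE !eqxx /= (agree_dim ag) dn modn_small; last by apply: ltn_cap; rewrite addn1.
by rewrite split_i Pi c addn1.
Qed.

(** Flattening of a three-dimensional array. [Dist] uses slice 0 only; in [Avd] the slice is the
    centre of the removed ball. *)
Definition cell_index (n m u v : nat) : nat := (m * n + u) * n + v.

Lemma cell_index_inj n m u v m' u' v' : u < n -> v < n -> u' < n -> v' < n ->
  cell_index n m u v = cell_index n m' u' v' -> [/\ m = m', u = u' & v = v'].
Proof.
have euclid k l b b' : b < n -> b' < n -> k * n + b = l * n + b' -> k = l /\ b = b'.
  move=> bn b'n E; have n0 : 0 < n by lia.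
  have := congr1 (divn^~ n) E; have := congr1 (modn^~ n) E.
  by rewrite /= !modnMDl !modn_small // !divnMDl // !divn_small // !addn0.
move=> un vn u'n v'n /euclid[]// /euclid[]// *; by split.
Qed.

Definition cell_expr x y (z : aexpr) : aexpr :=
  AAdd (AMul (AAdd (AMul x size_expr) y) size_expr) z.

Lemma aeval_cell s x y (z : aexpr) :
  aeval s (cell_expr x y z) = cell_index (dim s) (aeval s x) (aeval s y) (aeval s z).
Proof. by rewrite /= !min0n. Qed.

Lemma arun_store s a x y :
  arun (AStore a x y) s = set_arr s a (aeval s x) (aeval s y %% cap (dim s)).
Proof. by []. Qed.

Lemma arun_if s x p q :
  arun (AIf x p q) s = if holds s x then arun p s else arun q s.
Proof. by []. Qed.

Lemma arun_seq s p q : arun (ASeq p q) s = arun q (arun p s).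
Proof. by []. Qed.

Lemma aeval_arr s a x : aeval s (AArr a x) = s.2 a (aeval s x).
Proof. by []. Qed.

Lemma aeval_add s x y : aeval s (AAdd x y) = aeval s x + aeval s y.
Proof. by []. Qed.

Lemma aeval_const s k : aeval s (AConst k) = k.
Proof. by []. Qed.

Lemma holds_or s x y : holds s (AAdd x y) = holds s x || holds s y.
Proof. by rewrite /holds /= addn_eq0 negb_and. Qed.

Lemma aeval_var s a : aeval s (var a) = s.2 a 0.
Proof. by []. Qed.

Definition U := 0. Definition V := 1. Definition W := 2. Definition X := 3.
Definition Z := 4.

(* Bellman-Ford: slice [Z] of the array [a] receives the distances for the
   relation that [x] defines in terms of the variables [W] and [V]. *)
Definition relax_cmd a x : acmd :=
  let cell b c := cell_expr (var Z) (var b) (var c) in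
  ASeq
    (AFor U (AFor V
      (AIf (AAdd (lt_expr (var U) (var V)) (lt_expr (var V) (var U)))
        (AStore a (cell U V) size_expr)
        (AStore a (cell U V) (AConst 0)))))
    (AFor X (AFor U (AFor V (AFor W
      (AIf (AMul x (lt_expr (AAdd (AArr a (cell U W)) (AConst 1)) (AArr a (cell U V))))
        (AStore a (cell U V) (AAdd (AArr a (cell U W)) (AConst 1)))
        ASkip))))).

Section Relax.
Variables (n : nat) (e : rel 'I_n) (a : nat) (x : aexpr) (s : astate).
Hypotheses (dn : dim s = n) (a_gt : Z < a).
Let l := [:: a; U; V; W; X].
Let m := s.2 Z 0.
Hypothesis xP : forall (w v : 'I_n) s', agree l s s' ->
  s'.2 W 0 = w -> s'.2 V 0 = v -> holds s' x = e w v.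

Let A s' (u v : 'I_n) := s'.2 a (cell_index n m u v).
Let sound s' := forall u v : 'I_n, dist e u v <= A s' u v <= n.
Let outside s1 s2 := forall i, (forall u v : 'I_n, i <> cell_index n m u v) ->
  s2.2 a i = s1.2 a i.

Let Zl : Z \notin l. Proof. by rewrite inE negb_or neq_ltn a_gt. Qed.
Let aU : U != a. Proof. by move: a_gt; case: (a). Qed.
Let aV : V != a. Proof. by move: a_gt; case: (a) => [|[]]. Qed.
Let aW : W != a. Proof. by move: a_gt; case: (a) => [|[|[]]]. Qed.
Let aX : X != a. Proof. by move: a_gt; case: (a) => [|[|[|[]]]]. Qed.

Let A_set s' (i j u v : 'I_n) k :
  A (set_arr s' a (cell_index n m i j) k) u v = if (u == i) && (v == j) then k else A s' u v.
Proof.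
rewrite /A set_arrE eqxx /=; case: eqP => [/cell_index_inj[]//|ne].
  by move=> _ /val_inj -> /val_inj ->; rewrite !eqxx.
by case: andP => // -[/eqP ui /eqP vj]; case: ne; rewrite ui vj.
Qed.

Let A_var s' b j u v : b != a -> A (set_arr s' b 0 j) u v = A s' u v.
Proof. by move=> ba; rewrite /A set_arrE eq_sym (negPf ba). Qed.

Let outside_set s' (i j : 'I_n) k : outside s' (set_arr s' a (cell_index n m i j) k).
Proof. by move=> t ti; rewrite set_arrE; case: andP => // -[_ /eqP /ti]. Qed.

Let outside_var s' b j : b != a -> outside s' (set_arr s' b 0 j).
Proof. by move=> ba t ti; rewrite set_arrE eq_sym (negPf ba). Qed.

Let agree_facts s' : agree l s s' -> dim s' = n /\ s'.2 Z 0 = m.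
Proof. by move=> ag; rewrite (agree_dim ag) dn (agree_arr ag Zl). Qed.

(** The value [n] is also the junk value of [dist], so entries of disconnected pairs are correct
    from the start. *)
Let init (u v : 'I_n) := if u == v then 0 else n.

Let run_cell b c y s' : dim s' = n -> s'.2 Z 0 = m -> aeval s' y <= n ->
  arun (AStore a (cell_expr (var Z) (var b) (var c)) y) s'
  = set_arr s' a (cell_index n m (s'.2 b 0) (s'.2 c 0)) (aeval s' y).
Proof.
move=> d' z' yn; rewrite arun_store aeval_cell !aeval_var d' z' modn_small //.
exact: ltn_cap.
Qed.

Let known k s' := forall u v : 'I_n, dist e u v <= k -> A s' u v <= dist e u v.

Let Rel s1 s2 := [/\ agree l s1 s2, outside s1 s2
  & sound s1 -> sound s2 /\ forall u v, A s2 u v <= A s1 u v].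

Let Rrefl s1 : Rel s1 s1. Proof. by split. Qed.

Let Rtrans s1 s2 s3 : Rel s1 s2 -> Rel s2 s3 -> Rel s1 s3.
Proof.
move=> [a1 o1 i1] [a2 o2 i2]; split; first exact: agree_trans a2.
  by move=> i ni; rewrite o2 ?o1.
move=> /i1[so le1]; have [so2 le2] := i2 so; split=> // u v.
exact: leq_trans (le2 u v) (le1 u v).
Qed.

Let Rset b s1 j : b \in l -> b != a -> Rel s1 (set_arr s1 b 0 j).
Proof.
move=> bl ba; split; [exact: agree_set_arr|exact: outside_var|move=> so].
by split=> u v; rewrite A_var.
Qed.

Let known_mono k s1 s2 : Rel s1 s2 -> sound s1 -> known k s1 -> known k s2.
Proof.
by move=> [_ _ R] /R[_ le] kn u v uvk; apply: leq_trans (le u v) (kn u v uvk).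
Qed.

Let Ul : U \in l. Proof. by rewrite !inE eqxx orbT. Qed.
Let Vl : V \in l. Proof. by rewrite !inE eqxx !orbT. Qed.
Let Wl : W \in l. Proof. by rewrite !inE eqxx !orbT. Qed.
Let Xl : X \in l. Proof. by rewrite !inE eqxx !orbT. Qed.

Let body := AIf (AMul x (lt_expr (AAdd (AArr a (cell_expr (var Z) (var U) (var W))) (AConst 1))
                               (AArr a (cell_expr (var Z) (var U) (var V)))))
        (AStore a (cell_expr (var Z) (var U) (var V))
            (AAdd (AArr a (cell_expr (var Z) (var U) (var W))) (AConst 1)))
        ASkip.

Let run_body s' (u v w : 'I_n) : agree l s s' -> sound s' ->
  s'.2 U 0 = u -> s'.2 V 0 = v -> s'.2 W 0 = w ->
  Rel s' (arun body s') /\ (e w v -> A (arun body s') u v <= (A s' u w).+1).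
Proof.
move=> ag so u0 v0 w0; have [d' z'] := agree_facts ag.
have cellE b c : aeval s' (AArr a (cell_expr (var Z) (var b) (var c)))
    = s'.2 a (cell_index n m (s'.2 b 0) (s'.2 c 0)).
  by rewrite aeval_arr aeval_cell !aeval_var d' z'.
have addE y : aeval s' (AAdd y (AConst 1)) = (aeval s' y).+1 by rewrite /= addn1.
have -> : arun body s' = if e w v && ((A s' u w).+1 < A s' u v)
    then set_arr s' a (cell_index n m u v) (A s' u w).+1 else s'.
  rewrite arun_if holds_and (xP ag w0 v0) holds_lt.
  rewrite addE !cellE u0 v0 w0 -/(A s' u w) -/(A s' u v).
  case: ifP => // /andP[_ lt].
  have Auv : A s' u v <= n by have /andP[] := so u v.
  rewrite run_cell // addE cellE ?u0 ?v0 ?w0 //.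
  exact: leq_trans (ltnW lt) Auv.
case: ifP => [/andP[ewv lt]|nlt]; last first.
  by split=> // ewv; move: nlt; rewrite ewv /=; lia.
split; last by rewrite A_set !eqxx.
split; [by apply: agree_set_arr; rewrite !inE eqxx|exact: outside_set|move=> _].
have /andP[le1 _] := so u w; have /andP[_ le2] := so u v.
split=> i j; rewrite A_set; case: ifP => [/andP[/eqP -> /eqP ->]|_] //.
  apply/andP; split; last exact: leq_trans (ltnW lt) le2.
  exact: leq_trans (dist_edge u ewv) _.
exact: ltnW.
Qed.

(** Round [r] makes all pairs at distance at most [r.+1] exact. Updating in place is safe: entries
    only decrease and never drop below the distance. As distances are at most [n], [n] rounds
    suffice. *)
Lemma arun_relax_rounds : sound s -> (forall u, A s u u = 0) ->
  let s' := arun (AFor X (AFor U (AFor V (AFor W body)))) s in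
  [/\ agree l s s', outside s s' & forall u v, A s' u v = dist e u v].
Proof.
move=> so diag.
have dlt (u v : 'I_n) : dist e u v <= n.
  by have := dist_le_card e u v; rewrite card_ord.
have [|||R G] := @arun_pass n Rel (fun r s' => sound s' /\ known r.+1 s') X (AFor U (AFor V (AFor W body))) s dn Rrefl Rtrans.
- by move=> s1 j; apply: Rset.
- move=> r s1 s2 R12 [so1 kn1]; split; last exact: known_mono R12 so1 kn1.
  by case: R12 => _ _ /(_ so1)[].
- move=> r s1 R1 _ _ prev.
  have so1 : sound s1 by case: R1 => _ _ /(_ so)[].
  have kn1 : known r s1.
    case: (val r) (ltn_ord r) prev => [|r'] r'n prev.
      move=> u v; rewrite leqn0 => /eqP/dist_eq0 <-; rewrite distxx.
      by case: R1 => _ _ /(_ so)[_ /(_ u u)]; rewrite diag.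
    by have [] := prev (Ordinal (ltnW r'n)) (ltnSn r').
  have [d1 _] : dim s1 = n /\ _ := agree_facts (let: And3 ag _ _ := R1 in ag).
  have [|||R2 G2] := @arun_pass n Rel (fun u s' => sound s' /\
     forall v, dist e u v <= r.+1 -> A s' u v <= dist e u v) U (AFor V (AFor W body)) s1 d1 Rrefl Rtrans.
  + by move=> s2 j; apply: Rset.
  + move=> u s2 s3 [_ _ R] [/R[so3 le3] G]; split=> // v uv.
    exact: leq_trans (le3 u v) (G v uv).
  + move=> u s2 R2 u2 _ _; have so2 : sound s2 by case: R2 => _ _ /(_ so1)[].
    have d2 : dim s2 = n by case: R2 => ag _ _; rewrite (agree_dim ag).
    have [|||R3 G3] := @arun_pass n Rel (fun v s' => sound s' /\
       (dist e u v <= r.+1 -> A s' u v <= dist e u v)) V (AFor W body) s2 d2 Rrefl Rtrans.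
    * by move=> s3 j; apply: Rset.
    * move=> v s3 s4 [_ _ R] [/R[so4 le4] G]; split=> // uv.
      exact: leq_trans (le4 u v) (G uv).
    * move=> v s3 R3 v3 keep3 _; have so3 : sound s3 by case: R3 => _ _ /(_ so2)[].
      have d3 : dim s3 = n by case: R3 => ag _ _; rewrite (agree_dim ag).
      have u3 : s3.2 U 0 = u by rewrite keep3 //= ?andbT (eq_sym a) aU.
      have kn3 : known r s3 := known_mono R3 so2 (known_mono R2 so1 kn1).
      have [|||R4 G4] := @arun_pass n Rel (fun w s' => sound s' /\
         (dist e u w <= r -> e w v -> A s' u v <= r.+1)) W body s3 d3 Rrefl Rtrans.
      -- by move=> s4 j; apply: Rset.
      -- move=> w s4 s5 [_ _ R] [/R[so5 le5] G]; split=> // uw wv.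
         exact: leq_trans (le5 u v) (G uw wv).
      -- move=> w s4 R4 w4 keep4 _; have so4 : sound s4 by case: R4 => _ _ /(_ so3)[].
         have u4 : s4.2 U 0 = u by rewrite keep4 //= ?andbT (eq_sym a) aU.
         have v4 : s4.2 V 0 = v by rewrite keep4 //= ?andbT (eq_sym a) aV.
         have ag4 : agree l s s4 by case: (Rtrans R1 (Rtrans R2 (Rtrans R3 R4))).
         have [R5 G5] := run_body ag4 so4 u4 v4 w4; split=> //.
         split; first by case: R5 => _ _ /(_ so4)[].
         move=> uw wv; apply: leq_trans (G5 wv) _; rewrite ltnS.
         exact: leq_trans (known_mono R4 so3 kn3 uw) uw.
      split=> //; split=> [|uv]; first by case: R4 => _ _ /(_ so3)[].
      have so4 : sound (arun (AFor W body) s3) by case: R4 => _ _ /(_ so3)[].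
      have [uvr|ruv] := leqP (dist e u v) r; first exact: known_mono R4 so3 kn3 _ _ uvr.
      have uvE : dist e u v = r.+1 by apply/eqP; rewrite eqn_leq uv.
      (* For [r.+1 >= n] the general bound [n] on entries is enough; otherwise the distance is
         genuine and the loop over [W] meets the penultimate vertex of a shortest walk. *)
      have [rn|nr] := ltnP r.+1 n; last first.
        by have /andP[_ le] := so4 u v; rewrite uvE (leq_trans le).
      have [|w uw wv] := dist_pred uvE; first by rewrite card_ord.
      by have [_ G4w] := G4 w; rewrite uvE G4w.
    split=> //; split=> [|v]; first by case: R3 => _ _ /(_ so2)[].
    by case: (G3 v).
  split=> //; split=> [|u v uv]; first by case: R2 => _ _ /(_ so1)[].
  by case: (G2 u) => _; apply.
case: R => ag out /(_ so)[so' _]; split=> // u v; apply/eqP.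
have /andP[le1 le2] := so' u v; rewrite eqn_leq le1 andbT.
have n0 : 0 < n by apply: leq_ltn_trans (ltn_ord u).
have pn : n.-1 < n by rewrite prednK.
have [_ kn] := G (Ordinal pn); apply: kn => /=; rewrite prednK //.
Qed.

Let init_body := AIf (AAdd (lt_expr (var U) (var V)) (lt_expr (var V) (var U)))
        (AStore a (cell_expr (var Z) (var U) (var V)) size_expr)
        (AStore a (cell_expr (var Z) (var U) (var V)) (AConst 0)).

Lemma arun_relax_init :
  let s' := arun (AFor U (AFor V init_body)) s in
  [/\ agree l s s', outside s s' & forall u v, A s' u v = init u v].
Proof.
pose Ri s1 s2 := [/\ agree l s1 s2, outside s1 s2
  & forall u v, A s1 u v = init u v -> A s2 u v = init u v].
have Rirefl s1 : Ri s1 s1 by split.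
have Ritrans s1 s2 s3 : Ri s1 s2 -> Ri s2 s3 -> Ri s1 s3.
  move=> [a1 o1 i1] [a2 o2 i2]; split; first exact: agree_trans a2.
    by move=> i ni; rewrite o2 ?o1.
  by move=> u v /i1/i2.
have Riset b s1 j : b \in l -> b != a -> Ri s1 (set_arr s1 b 0 j).
  move=> bl ba; split; first exact: agree_set_arr.
    exact: outside_var.
  by move=> u v; rewrite A_var.
have RU := Riset U; have RV := Riset V.
have [|||[ag o _] G] := @arun_pass n Ri (fun u s1 => forall v, A s1 u v = init u v) U (AFor V init_body) s dn Rirefl Ritrans.
- by move=> s1 j; apply: RU => //; rewrite !inE eqxx orbT.
- by move=> i s1 s2 [_ _ R] G v; apply: R.
- move=> i s1 R1 ui _ _.
  have [ag1 _ _] := R1; have [d1 _] := agree_facts ag1.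
  apply: (@arun_pass n Ri (fun v s2 => A s2 i v = init i v)) => //.
  + by move=> s2 j; apply: RV => //; rewrite !inE eqxx !orbT.
  + by move=> j s2 s3 [_ _ R]; apply: R.
  move=> j s2 R2 vj keep _; have [ag2 _ _] := Ritrans _ _ _ R1 R2.
  have [d2 z2] := agree_facts ag2.
  have u2 : s2.2 U 0 = i by rewrite keep //= ?andbT (eq_sym a) aU.
  pose y := if i == j then AConst 0 else size_expr.
  have yk : aeval s2 y = init i j by rewrite /y /init; case: ifP; rewrite ?aeval_size.
  have -> : arun init_body s2
      = set_arr s2 a (cell_index n m i j) (init i j).
    rewrite -yk -u2 -vj -run_cell ?yk //; last by rewrite /init; case: ifP.
    rewrite arun_if holds_or !holds_lt !aeval_var u2 vj.
    rewrite -neq_ltn /y; case: (eqVneq i j) => [->|ij]; first by rewrite eqxx.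
    by rewrite ifT.
  split; last by rewrite A_set !eqxx.
  split; [by apply: agree_set_arr; rewrite !inE eqxx|exact: outside_set|].
  by move=> u v Auv; rewrite A_set; case: andP => // -[/eqP -> /eqP ->].
by split=> // u v; apply: G.
Qed.

End Relax.

Lemma arun_relax n (e : rel 'I_n) a x s (m := s.2 Z 0) (l := [:: a; U; V; W; X]) :
  dim s = n -> Z < a ->
  (forall (w v : 'I_n) s', agree l s s' ->
     s'.2 W 0 = w -> s'.2 V 0 = v -> holds s' x = e w v) ->
  let s' := arun (relax_cmd a x) s in
  [/\ agree l s s',
      forall i, (forall u v : 'I_n, i <> cell_index n m u v) -> s'.2 a i = s.2 a i
    & forall u v : 'I_n, s'.2 a (cell_index n m u v) = dist e u v].
Proof.
move=> dn aZ xP; have [] := arun_relax_init dn aZ.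
rewrite /relax_cmd arun_seq; set s1 := arun _ s => ag out init.
have d1 : dim s1 = n by rewrite (agree_dim ag).
have Z1 : s1.2 Z 0 = m by rewrite (agree_arr ag) // inE negb_or neq_ltn aZ.
have xP1 (w v : 'I_n) s' : agree l s1 s' ->
    s'.2 W 0 = w -> s'.2 V 0 = v -> holds s' x = e w v.
  by move=> /(agree_trans ag); apply: xP.
have [||ag2 out2 A2] := arun_relax_rounds d1 aZ xP1.
- move=> u v; rewrite Z1 init; case: eqP => [->|_]; first by rewrite distxx.
  by have := dist_le_card e u v; rewrite card_ord leqnn andbT.
- by move=> u; rewrite Z1 init eqxx.
split; [exact: agree_trans ag ag2| |by move=> u v; rewrite -Z1 A2].
by move=> i ni; rewrite out2 ?out // Z1.
Qed.

End ArrayPrograms.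

(** * The algorithm *)

Definition Dist := 5. Definition Avd := 6. Definition Dead := 7.
Definition Cnt := 8. Definition Root := 9. Definition Best := 10.
Definition Pos := 11. Definition Flag := 12.

(** The integer ceiling of [c]; cells 2 and 3 hold its numerator and denominator. *)
Definition c_expr : aexpr :=
  ADiv (ASub (AAdd (ALow (AConst 2)) (ALow (AConst 3))) (AConst 1)) (ALow (AConst 3)).
Definition radius_expr : aexpr := AMul (AConst 10) c_expr.
(** Twice what [transversal_dball] allows at radius 10 C, so that more than half of the live part of
    an overfull ball lies in every transversal. *)
Definition density_expr : aexpr :=
  AMul (AConst 2) (AAdd (AMul (AConst 2) (AMul c_expr radius_expr)) (AConst 1)).
Definition adj_expr (x y : aexpr) : aexpr :=
  ALow (AAdd (AConst 4) (AAdd (AMul x size_expr) y)).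
Definition dist_expr a b : aexpr :=
  AArr Dist (cell_expr (AConst 0) (var a) (var b)).
Definition avoids_expr a b c : aexpr :=
  AMul (lt_expr c_expr (dist_expr a b))
    (AMul (lt_expr c_expr (dist_expr a c))
      (lt_expr (AArr Avd (cell_expr (var a) (var b) (var c))) size_expr)).
Definition alive_expr a : aexpr := not_expr (AArr Dead (var a)).
Definition kill_cmd a : acmd := AStore Dead (var a) (AConst 1).

Definition dist_cmd : acmd := relax_cmd Dist (adj_expr (var W) (var V)).
Definition avoid_edge_expr : aexpr :=
  AMul (adj_expr (var W) (var V))
    (AMul (lt_expr c_expr (dist_expr Z W)) (lt_expr c_expr (dist_expr Z V))).
Definition avoid_cmd : acmd := AFor Z (relax_cmd Avd avoid_edge_expr).
Definition connect_cmd : acmd :=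
  AFor U (AFor V
    (AIf (AMul (alive_expr U) (AMul (alive_expr V) (le_expr size_expr (dist_expr U V))))
      (ASeq (kill_cmd U) (kill_cmd V)) ASkip)).
Definition asteroidal_cmd : acmd :=
  AFor U (AFor V (AFor W
    (AIf (AMul (AMul (alive_expr U) (AMul (alive_expr V) (alive_expr W)))
           (AMul (avoids_expr U V W) (AMul (avoids_expr V U W) (avoids_expr W U V))))
      (ASeq (kill_cmd U) (ASeq (kill_cmd V) (kill_cmd W))) ASkip))).
Definition density_cmd : acmd :=
  AFor U
    (ASeq (count_cmd Cnt V (AMul (alive_expr V) (le_expr (dist_expr U V) radius_expr)))
      (AIf (lt_expr density_expr (var Cnt))
        (AFor V (AIf (le_expr (dist_expr U V) radius_expr) (kill_cmd V) ASkip))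
        ASkip)).

(** The comparison with [Best] is not strict, so that the initial 0 is replaced, and a root found,
    even if a single vertex is alive. *)
Definition root_cmd : acmd :=
  AFor U (AFor V
    (AIf (AMul (alive_expr U) (AMul (alive_expr V) (le_expr (var Best) (dist_expr U V))))
      (ASeq (AStore Best (AConst 0) (dist_expr U V)) (AStore Root (AConst 0) (var U)))
      ASkip)).
(** The minimum of the density bound and [n], by truncated subtraction. The cap at [n] keeps
    positions below [cap], while the scale still exceeds every rank of a live vertex. *)
Definition scale_expr : aexpr := ASub size_expr (ASub size_expr density_expr).
Definition rank_expr : aexpr :=
  AMul (alive_expr V) (AMul (lt_expr (var V) (var U))
    (AMul (le_expr (dist_expr Root V) (dist_expr Root U))
          (le_expr (dist_expr Root U) (dist_expr Root V)))).
Definition pos_cmd : acmd :=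
  AFor U (ASeq (count_cmd Cnt V rank_expr)
    (AStore Pos (var U) (AAdd (AMul scale_expr (dist_expr Root U)) (var Cnt)))).
(** 63 is 3 times 21: the loss of greedy deletion times the constant of [line_transversal]. *)
Definition flag_cmd : acmd :=
  ASeq (count_cmd Cnt V (AArr Dead (var V)))
    (AIf (le_expr (var Cnt)
           (AMul (AConst 63) (AMul (AMul c_expr c_expr) (ALow (AConst 1)))))
      (AStore Flag (AConst 0) (AConst 1)) ASkip).
Definition out_cell k : aexpr := AAdd (AConst k) (AMul (AConst 4) (var U)).
Definition out_cmd : acmd :=
  AFor U (ASeq (AOut (out_cell 1) (not_expr (alive_expr U)))
         (ASeq (AOut (out_cell 2) (AArr Pos (var U)))
         (ASeq (AOut (out_cell 3) (AConst 0))
               (AOut (out_cell 4) (AConst 1))))).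

(** Further deletions preserve what a deletion stage has achieved, so one pass of each suffices. The
    output overwrites the input, so the verdict is first saved in [Flag]. *)
Definition algorithm : acmd :=
  foldr ASeq ASkip [:: dist_cmd; avoid_cmd; connect_cmd; asteroidal_cmd;
    density_cmd; root_cmd; pos_cmd; flag_cmd; out_cmd].

Lemma setD_id (T : finType) (A B : {set T}) :
  {in A, forall w, w \notin B} -> (A :\: B = A)%SET.
Proof.
move=> AB; apply/setP => w; rewrite finset.in_setD.
by have [/AB ->|_] := boolP (w \in A); rewrite ?andbF.
Qed.

(** * Correctness of the individual stages *)

Section Program.
Implicit Types s : astate.
Variables (n : nat) (e : rel 'I_n) (L : nat -> nat).
Hypotheses (L0 : L 0 = n).
Hypothesis (Ladj : forall i j : 'I_n, L (4 + (i * n + j)) = e i j).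
Let C := (L 2 + L 3 - 1) %/ L 3.

Lemma ltn_mul_ord (i j : 'I_n) : i * n + j < n * n.
Proof. by have := ltn_ord i; have := ltn_ord j; nia. Qed.

Lemma minn_low_max i m : i <= 4 -> minn i (low_max m) = i.
Proof. by move=> i4; apply/minn_idPl; apply: leq_trans i4 (leq_addr _ _). Qed.

Section Eval.
Variable s : astate.
Hypothesis sL : s.1 = L.

Lemma dimL : dim s = n. Proof. by rewrite /dim sL. Qed.

Lemma aeval_c : aeval s c_expr = C.
Proof. by rewrite /= !minn_low_max // sL. Qed.

Lemma aeval_radius : aeval s radius_expr = 10 * C.
Proof. by rewrite -[LHS]/(10 * aeval s c_expr) aeval_c. Qed.

Lemma aeval_density : aeval s density_expr = 2 * (2 * C * (10 * C)).+1.
Proof.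
rewrite -[LHS]/(2 * (2 * (aeval s c_expr * aeval s radius_expr) + 1)).
by rewrite aeval_c aeval_radius mulnA addn1.
Qed.

Lemma holds_adj a b (i j : 'I_n) : s.2 a 0 = i -> s.2 b 0 = j ->
  holds s (adj_expr (var a) (var b)) = e i j.
Proof.
move=> ai bj; rewrite /holds /= ai bj min0n sL L0 (minn_idPl _) ?Ladj.
  by case: (e i j).
by rewrite leq_add2l dimL ltnW // ltn_mul_ord.
Qed.

Definition has_dist := forall u v : 'I_n, s.2 Dist (cell_index n 0 u v) = dist e u v.
Definition has_avoid := forall m u v : 'I_n,
  s.2 Avd (cell_index n m u v) = dist (avoid e C m) u v.

Lemma aeval_dist a b (i j : 'I_n) : has_dist -> s.2 a 0 = i -> s.2 b 0 = j ->
  aeval s (dist_expr a b) = dist e i j.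
Proof.
by move=> sD ai bj; rewrite aeval_arr aeval_cell aeval_const !aeval_var ai bj dimL sD.
Qed.

Lemma holds_avoids a b c (m i j : 'I_n) : has_dist -> has_avoid ->
  s.2 a 0 = m -> s.2 b 0 = i -> s.2 c 0 = j ->
  holds s (avoids_expr a b c) = avoids e C m i j.
Proof.
move=> sD sA am bi cj; rewrite !holdsE aeval_c (aeval_dist sD am bi).
rewrite (aeval_dist sD am cj) aeval_size dimL aeval_arr aeval_cell !aeval_var.
by rewrite am bi cj dimL sA /avoids connect_dist card_ord.
Qed.

Definition dead : {set 'I_n} := [set v : 'I_n | s.2 Dead v != 0]%SET.

Lemma holds_alive a (i : 'I_n) : s.2 a 0 = i -> holds s (alive_expr a) = (i \notin dead).
Proof. by move=> ai; rewrite holds_not /holds aeval_arr aeval_var ai inE. Qed.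

End Eval.

Lemma dead_eq s s' : s'.2 Dead = s.2 Dead -> dead s' = dead s.
Proof. by move=> E; apply/setP => v; rewrite !inE E. Qed.

Lemma agree_dead l' s s' : agree l' s s' -> Dead \notin l' -> dead s' = dead s.
Proof. by move=> ag dl; apply: dead_eq; rewrite (agree_arr ag). Qed.

Lemma dead_kill a s (i : 'I_n) : s.1 = L -> s.2 a 0 = i ->
  agree [:: Dead] s (arun (kill_cmd a) s) /\
  dead (arun (kill_cmd a) s) = (i |: dead s)%SET.
Proof.
move=> sL ai; rewrite arun_store aeval_var ai modn_small; last first.
  by apply: ltn_cap; rewrite (dimL sL) (leq_ltn_trans _ (ltn_ord i)).
split; first exact: agree_set_arr.
apply/setP => v; rewrite !inE set_arrE eqxx /=.
by case: (eqVneq v i) => [->|vi]; rewrite ?eqxx // ifN.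
Qed.

Definition input_state : astate := (L, fun _ _ => 0).

Lemma arun_dist (s := arun dist_cmd input_state) :
  agree [:: Dist; U; V; W; X] input_state s /\ has_dist s.
Proof.
have [|ag _ D] := @arun_relax n e Dist (adj_expr (var W) (var V)) input_state L0 isT.
  by move=> w v s' ag; apply: holds_adj; rewrite ag.1.
by split.
Qed.

Lemma arun_avoid s : s.1 = L -> has_dist s ->
  agree [:: Avd; U; V; W; X; Z] s (arun avoid_cmd s) /\ has_avoid (arun avoid_cmd s).
Proof.
move=> sL sD; set l := [:: _; _; _; _; _; _].
pose I k s' := agree l s s' /\ forall m u v : 'I_n, m < k ->
  s'.2 Avd (cell_index n m u v) = dist (avoid e C m) u v.
suff [ag A] : I n (arun avoid_cmd s) by split=> // m u v; apply: A.
apply: (arun_for (dimL sL)) => //.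
  move=> k s' [ag A] j; split=> [|m u v mk]; last by rewrite set_arrE A.
  by apply: agree_trans ag (agree_set_arr _ _ _ _); rewrite !inE.
move=> m s' [ag A] Zm; have s'L : s'.1 = L by rewrite ag.1.
have s'D : has_dist s' by move=> u v; rewrite (agree_arr ag).
have [|ag' out A'] := @arun_relax n (avoid e C m) Avd avoid_edge_expr s' (dimL s'L) isT.
  move=> w v s1 ag1 wE vE; have s1L : s1.1 = L by rewrite ag1.1.
  have s1D : has_dist s1 by move=> i j; rewrite (agree_arr ag1).
  have Z1 : s1.2 Z 0 = m by rewrite (agree_arr ag1).
  by rewrite !holdsE aeval_c // (holds_adj s1L wE vE) (aeval_dist s1L s1D Z1 wE) (aeval_dist s1L s1D Z1 vE).
split; first by apply: agree_trans ag (agree_sub _ ag'); apply/allP.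
move=> m' u v; rewrite ltnS leq_eqVlt => /orP[/eqP/val_inj ->|m'm].
  by rewrite -A' Zm.
rewrite out ?A // => u' v' /cell_index_inj[]// mm; by move: m'm; rewrite mm Zm ltnn.
Qed.

Definition ready s := [/\ s.1 = L, has_dist s & has_avoid s].

Lemma agree_ready l s s' : agree l s s' -> Dist \notin l -> Avd \notin l ->
  ready s -> ready s'.
Proof.
move=> ag dl al [sL sD sA]; split; first by rewrite ag.1.
  by move=> u v; rewrite (agree_arr ag).
by move=> m u v; rewrite (agree_arr ag).
Qed.

(** The accounting quantifies over all transversals, since the program never knows one. *)
Definition thrifty s := forall Q : {set 'I_n}, transversal e C Q ->
  #|dead s| <= 3 * #|Q :&: dead s|.

Let l := [:: U; V; W; Dead; Cnt].

Definition prunes s s' := [/\ agree l s s', (dead s \subset dead s')%SET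
  & thrifty s -> thrifty s'].

Lemma prunes_refl s : prunes s s. Proof. by split. Qed.

Lemma prunes_trans s1 s2 s3 : prunes s1 s2 -> prunes s2 s3 -> prunes s1 s3.
Proof.
move=> [a1 d1 t1] [a2 d2 t2]; split; first exact: agree_trans a2.
  exact: fintype.subset_trans d2.
by move/t1/t2.
Qed.

Lemma agree_prunes l' s s' : agree l' s s' -> {subset l' <= l} ->
  Dead \notin l' -> prunes s s'.
Proof.
move=> ag sub dl; have dE : dead s' = dead s by apply: dead_eq; rewrite (agree_arr ag).
by split; [exact: agree_sub ag|rewrite dE|rewrite /thrifty dE].
Qed.

Lemma prunes_var s b j : b \in [:: U; V; W; Cnt] -> prunes s (set_arr s b 0 j).
Proof.
move=> bl; apply: (@agree_prunes [:: b]); first by apply: agree_set_arr; rewrite inE.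
  move=> a; rewrite inE => /eqP ->; move: bl; rewrite !inE.
  by case/or4P=> /eqP ->.
by rewrite inE; move: bl; rewrite !inE => /or4P[]/eqP ->.
Qed.

Lemma prunes_ready s s' : prunes s s' -> ready s -> ready s'.
Proof. by case=> ag _ _; apply: agree_ready ag _ _. Qed.

(** Only newly deleted vertices are charged. They are disjoint from the earlier ones, so the
    inequalities add up. *)
Lemma prunes_kill s s' (S : {set 'I_n}) : agree l s s' -> dead s' = (S :|: dead s)%SET ->
  (forall Q, transversal e C Q -> #|S :\: dead s| <= 3 * #|Q :&: (S :\: dead s)|) ->
  prunes s s'.
Proof.
move=> ag dE SQ; split=> //; first by rewrite dE finset.subsetUr.
move=> th Q tQ; have := th Q tQ; have := SQ Q tQ; rewrite dE.
have -> : (S :|: dead s = (S :\: dead s) :|: dead s)%SET.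
  by apply/setP => v; rewrite !inE; case: (s.2 Dead v == 0); rewrite ?andbF ?orbT ?andbT.
set S' := (S :\: dead s)%SET => SQ' th'.
have dis : [disjoint S' & dead s]%SET.
  by rewrite -setI_eq0; apply/eqP/setP => v; rewrite !inE; case: (s.2 Dead v == 0); rewrite ?andbF.
have dis2 : [disjoint Q :&: S' & Q :&: dead s]%SET.
  by apply: disjointWl (finset.subsetIr _ _) _; apply: disjointWr (finset.subsetIr _ _) dis.
have cU (A B : {set 'I_n}) : [disjoint A & B]%SET -> #|A :|: B|%SET = #|A| + #|B|.
  by move=> AB; apply/eqP; rewrite (leq_card_setU A B).
by rewrite finset.setIUr !cU // mulnDr leq_add.
Qed.

Lemma dead_kill_agree a s (i : 'I_n) : s.1 = L -> s.2 a 0 = i ->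
  agree l s (arun (kill_cmd a) s) /\ dead (arun (kill_cmd a) s) = (i |: dead s)%SET.
Proof.
move=> sL ai; have [ag dE] := dead_kill sL ai; split=> //.
by apply: agree_sub ag => b; rewrite inE => /eqP ->.
Qed.

Lemma arun_connect s : ready s ->
  prunes s (arun connect_cmd s) /\
  {in ~: dead (arun connect_cmd s) &, forall u v, connect e u v}%SET.
Proof.
move=> rs; pose G (u v : 'I_n) s' := u \notin dead s' -> v \notin dead s' -> connect e u v.
have Gst u v s1 s2 : prunes s1 s2 -> G u v s1 -> G u v s2.
  by move=> [_ /fintype.subsetP sub _] G1 u2 v2; apply: G1; [apply: contra u2|apply: contra v2]; apply: sub.
suff [R Guv] : prunes s (arun connect_cmd s) /\ forall u v, G u v (arun connect_cmd s).
  by split=> // u v; rewrite !finset.in_setC => ua va; apply: Guv.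
have [sL _ _] := rs; apply: (@arun_pass n prunes (fun u s' => forall v, G u v s')
  U _ s (dimL sL) prunes_refl prunes_trans).
- by move=> s1 j; apply: prunes_var.
- by move=> u s1 s2 R G1 v; apply: Gst R (G1 v).
- move=> u s1 R1 u1 _ _; have r1 := prunes_ready R1 rs; have [L1 _ _] := r1.
  apply: (@arun_pass n prunes (G u) V _ s1 (dimL L1) prunes_refl prunes_trans).
  + by move=> s2 j; apply: prunes_var.
  + by move=> v s2 s3; apply: Gst.
  move=> v s2 R2 v2 keep2 _; have r2 := prunes_ready R2 r1; have [L2 D2 A2] := r2.
  have u2 : s2.2 U 0 = u by rewrite keep2.
  rewrite arun_if !holds_and (holds_alive u2) (holds_alive v2) holds_le (aeval_dist L2 D2 u2 v2).
  rewrite aeval_size (dimL L2); case: ifPn; last first.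
    move=> nc; split=> // ua va; move: nc.
    by rewrite ua va /= -ltnNge connect_dist card_ord.
  move=> /and3P[ua va nc]; rewrite arun_seq.
  have [ag3 d3] := dead_kill_agree L2 u2; set s3 := arun _ s2 in ag3 d3 *.
  have L3 : s3.1 = L by rewrite ag3.1.
  have v3 : s3.2 V 0 = v by rewrite arun_keeps.
  have [ag4 d4] := dead_kill_agree L3 v3; set s4 := arun _ s3 in ag4 d4 *.
  have dE : dead s4 = ([set u; v] :|: dead s2)%SET.
    by rewrite d4 d3 finset.setUA (finset.setUC [set v]%SET).
  split; last by rewrite /G dE !inE eqxx.
  apply: prunes_kill (agree_trans ag3 ag4) dE _ => Q tQ.
  have -> : ([set u; v] :\: dead s2 = [set u; v])%SET.
    by apply: setD_id => w; rewrite !in_set2 => /orP[]/eqP ->.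
  apply: (@leq_trans 2); first by rewrite cards2; case: (_ != _).
  suff : 0 < #|Q :&: [set u; v]|%SET by lia.
  rewrite card_gt0; apply: contraTneq nc => Q0; rewrite -ltnNge.
  have outQ w : w \in [set u; v]%SET -> w \in (~: Q)%SET.
    move=> wuv; rewrite inE; apply: contraTN isT => wQ.
    by have : w \in (Q :&: [set u; v])%SET; [rewrite inE wQ|rewrite Q0 inE].
  have := transversal_connect tQ (outQ u _) (outQ v _).
  by rewrite connect_dist card_ord; apply; rewrite !inE eqxx ?orbT.
Qed.

Lemma arun_asteroidal s : ready s ->
  prunes s (arun asteroidal_cmd s) /\
  {in ~: dead (arun asteroidal_cmd s) & &, forall x y z, ~~ asteroidal e C x y z}%SET.
Proof.
move=> rs; pose G (u v w : 'I_n) s' :=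
  u \notin dead s' -> v \notin dead s' -> w \notin dead s' -> ~~ asteroidal e C u v w.
have Gst u v w s1 s2 : prunes s1 s2 -> G u v w s1 -> G u v w s2.
  move=> [_ /fintype.subsetP sub _] G1 u2 v2 w2.
  by apply: G1; [apply: contra u2|apply: contra v2|apply: contra w2]; apply: sub.
suff [R Guv] : prunes s (arun asteroidal_cmd s) /\
    forall u v w, G u v w (arun asteroidal_cmd s).
  by split=> // u v w; rewrite !finset.in_setC => ua va wa; apply: Guv.
have [sL _ _] := rs; apply: (@arun_pass n prunes (fun u s' => forall v w, G u v w s')
  U _ s (dimL sL) prunes_refl prunes_trans).
- by move=> s1 j; apply: prunes_var.
- by move=> u s1 s2 R G1 v w; apply: Gst R (G1 v w).
move=> u s1 R1 u1 _ _; have r1 := prunes_ready R1 rs; have [L1 _ _] := r1.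
apply: (@arun_pass n prunes (fun v s' => forall w, G u v w s')
  V _ s1 (dimL L1) prunes_refl prunes_trans).
- by move=> s2 j; apply: prunes_var.
- by move=> v s2 s3 R G2 w; apply: Gst R (G2 w).
move=> v s2 R2 v2 keep2 _; have r2 := prunes_ready R2 r1; have [L2 _ _] := r2.
have u2 : s2.2 U 0 = u by rewrite keep2.
apply: (@arun_pass n prunes (G u v) W _ s2 (dimL L2) prunes_refl prunes_trans).
- by move=> s3 j; apply: prunes_var.
- by move=> w s3 s4; apply: Gst.
move=> w s3 R3 w3 keep3 _; have r3 := prunes_ready R3 r2; have [L3 D3 A3] := r3.
have u3 : s3.2 U 0 = u by rewrite keep3.
have v3 : s3.2 V 0 = v by rewrite keep3.
have h1 : holds s3 (avoids_expr U V W) = avoids e C u v w by apply: holds_avoids.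
have h2 : holds s3 (avoids_expr V U W) = avoids e C v u w by apply: holds_avoids.
have h3 : holds s3 (avoids_expr W U V) = avoids e C w u v by apply: holds_avoids.
rewrite arun_if; move: (avoids_expr U V W) (avoids_expr V U W) (avoids_expr W U V) h1 h2 h3.
move=> x1 x2 x3 h1 h2 h3; rewrite !holds_and h1 h2 h3.
rewrite (holds_alive u3) (holds_alive v3) (holds_alive w3).
rewrite -/(asteroidal e C u v w); case: ifPn; last first.
  by move=> na; split=> // ua va wa; move: na; rewrite ua va wa.
move=> /andP[/and3P[ua va wa] ast]; rewrite !arun_seq.
have [ag4 d4] := dead_kill_agree L3 u3; set s4 := arun _ s3 in ag4 d4 *.
have L4 : s4.1 = L by rewrite ag4.1.
have v4 : s4.2 V 0 = v by rewrite arun_keeps.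
have [ag5 d5] := dead_kill_agree L4 v4; set s5 := arun _ s4 in ag5 d5 *.
have L5 : s5.1 = L by rewrite ag5.1.
have w5 : s5.2 W 0 = w by rewrite !arun_keeps.
have [ag6 d6] := dead_kill_agree L5 w5; set s6 := arun _ s5 in ag6 d6 *.
clearbody s6; clearbody s5; clearbody s4.
have dE : dead s6 = ([set u; v; w] :|: dead s3)%SET.
  rewrite d6 d5 d4 !finset.setUA; congr (_ :|: _)%SET.
  by rewrite finset.setUC (finset.setUC [set w]%SET) finset.setUA.
split; last by rewrite /G dE !inE eqxx.
apply: prunes_kill (agree_trans ag4 (agree_trans ag5 ag6)) dE _ => Q tQ.
have -> : ([set u; v; w] :\: dead s3 = [set u; v; w])%SET.
  apply: setD_id => t; rewrite finset.in_setU finset.in_set1 in_set2 -orbA.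
  by case/or3P=> /eqP ->.
(* One vertex of [Q] pays for three deletions; this case dictates the factor 3. *)
apply: (@leq_trans 3).
  by rewrite (leq_trans (leq_card_setU _ _)) // cards1 cards2; case: (_ != _).
suff Q_gt0 : 0 < #|Q :&: [set u; v; w]|%SET by apply: (leq_mul (leqnn 3) Q_gt0).
rewrite card_gt0; apply/negP=> /eqP Q0.
suff : ~~ asteroidal e C u v w by rewrite ast.
have outQ t : t \in [set u; v; w]%SET -> t \in (~: Q)%SET.
  move=> tuv; rewrite finset.in_setC; apply: contraTN isT => tQ'.
  by have : t \in (Q :&: [set u; v; w])%SET; [rewrite finset.in_setI tQ'|rewrite Q0 finset.in_set0].
by apply: (transversal_asteroidal tQ); apply: outQ; rewrite !inE eqxx ?orbT.
Qed.

Lemma arun_density s : ready s ->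
  prunes s (arun density_cmd s) /\
  forall u, #|~: dead (arun density_cmd s) :&: dball e u (10 * C)|%SET
            <= 2 * (2 * C * (10 * C)).+1.
Proof.
move=> rs; set M := 2 * _.
pose G (u : 'I_n) s' := #|~: dead s' :&: dball e u (10 * C)|%SET <= M.
have Gst u s1 s2 : prunes s1 s2 -> G u s1 -> G u s2.
  move=> [_ sub _] G1; apply: leq_trans G1; apply: subset_leq_card.
  by apply: finset.setSI; rewrite finset.setCS.
have [sL _ _] := rs; apply: (@arun_pass n prunes G U _ s (dimL sL) prunes_refl prunes_trans) => //.
  by move=> s1 j; apply: prunes_var.
move=> u s1 R1 u1 _ _; have r1 := prunes_ready R1 rs; have [L1 D1 A1] := r1.
rewrite arun_seq.
pose P := [pred v : 'I_n | (v \notin dead s1) && (dist e u v <= 10 * C)].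
have [|ag2 c2] := @arun_count n Cnt V (AMul (alive_expr V) (le_expr (dist_expr U V) radius_expr)) s1 P (dimL L1) isT.
  move=> v s' ag v'; have [L' D' _] := agree_ready ag isT isT r1.
  have u' : s'.2 U 0 = u by rewrite (agree_arr ag).
  rewrite holds_and (holds_alive v') holds_le (aeval_dist L' D' u' v') (aeval_radius L').
  by rewrite (agree_dead ag isT).
set s2 := arun _ s1 in ag2 c2 *.
have r2 := agree_ready ag2 isT isT r1; have [L2 D2 A2] := r2.
have u2 : s2.2 U 0 = u by rewrite (agree_arr ag2).
have d2 : dead s2 = dead s1 by apply: dead_eq; rewrite (agree_arr ag2).
have R2 : prunes s1 s2.
  by apply: agree_prunes ag2 _ isT; apply/allP.
have PE : #|P| = #|~: dead s1 :&: dball e u (10 * C)|%SET.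
  by apply: eq_card => v; rewrite !inE.
rewrite arun_if holds_lt (aeval_density L2) aeval_var c2 -/M PE.
have [gt|le] := ltnP; last by rewrite /G d2.
(* Bounding the deletions from above by the ball, and from below through [all3], determines the new
   dead set exactly. *)
pose Q1 s1 s2 := [/\ agree [:: V; Dead] s1 s2,
  (dead s1 \subset dead s2)%SET & (dead s2 \subset dead s1 :|: dball e u (10 * C))%SET].
set kill := AFor V _.
have [[ag3 sub1 sub2] all3] : Q1 s2 (arun kill s2) /\
     forall v, v \in dball e u (10 * C) -> v \in dead (arun kill s2).
  apply: (@arun_pass n Q1 (fun v s' => v \in dball e u (10 * C) -> v \in dead s') V _ s2 (dimL L2)).
  - by move=> s3; split; rewrite ?finset.subsetUl.
  - move=> s3 s4 s5 [a1 b1 c1] [a3 b3 c3]; split; first exact: agree_trans a3.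
      exact: fintype.subset_trans b3.
    apply: fintype.subset_trans c3 _; rewrite finset.subUset finset.subsetUr andbT.
    exact: c1.
  - by move=> s3 j; split; [exact: agree_set_arr|exact: fintype.subxx|exact: finset.subsetUl].
  - by move=> v s3 s4 [_ /fintype.subsetP sub _] h /h/sub.
  move=> v s3 [ag3 sub3 _] v3 keep3 _; have [L3 D3 _] := agree_ready ag3 isT isT r2.
  have u3 : s3.2 U 0 = u by rewrite (agree_arr ag3).
  rewrite arun_if holds_le (aeval_dist L3 D3 u3 v3) (aeval_radius L3).
  case: ifPn => [uv|nuv]; last first.
    split; last by rewrite !inE (negPf nuv).
    by split; rewrite ?finset.subsetUl.
  have [ag4 d4] := dead_kill L3 v3; rewrite /Q1 d4; split; last by rewrite !inE eqxx.
  split; first by apply: agree_sub ag4; apply/allP.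
    exact: finset.subsetUr.
  rewrite finset.subUset finset.subsetUl andbT finset.sub1set !inE uv.
  by rewrite orbT.
set s3 := arun _ s2 in ag3 sub1 sub2 all3 *.
have dE : dead s3 = (dball e u (10 * C) :|: dead s2)%SET.
  apply/eqP; rewrite finset.eqEsubset finset.setUC sub2 finset.subUset sub1 /=.
  by apply/fintype.subsetP.
split; last first.
  rewrite /G dE (_ : _ :&: _ = finset.set0)%SET ?cards0 //.
  by apply/setP => v; rewrite !inE negb_or; case: (_ <= _); rewrite ?andbF.
apply: prunes_trans R2 _; apply: prunes_kill dE _.
  by apply: agree_sub ag3; apply/allP.
move=> Q tQ; rewrite d2; set S := (_ :\: _)%SET.
have SE : S = (~: dead s1 :&: dball e u (10 * C))%SET by rewrite /S finset.setDE finset.setIC.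
(* At most half of the threshold [M] can lie outside [Q], so more than half of [S] is in [Q]. *)
have := transversal_dball tQ u (10 * C); rewrite -SE in gt.
have : #|S :\: Q|%SET <= #|~: Q :&: dball e u (10 * C)|%SET.
  apply: subset_leq_card; apply/fintype.subsetP=> v.
  by rewrite /S !inE => /and3P[-> _ ->].
have := cardsID Q S; rewrite (finset.setIC S Q); move: gt; rewrite /M.
move: (2 * C * (10 * C)) => m h1 h2 h3 h4.
move: h1 (leq_trans h3 h4); rewrite -h2.
by move: #|S :\: Q|%SET #|Q :&: S|%SET => r q; clear; lia.
Qed.
Lemma arun_root s : ready s -> s.2 Best 0 = 0 ->
  agree [:: U; V; Best; Root] s (arun root_cmd s) /\
  forall u v, u \notin dead s -> v \notin dead s -> exists a w : 'I_n,
    [/\ a \notin dead s, w \notin dead s, (arun root_cmd s).2 Root 0 = a,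
        (arun root_cmd s).2 Best 0 = dist e a w
      & dist e u v <= (arun root_cmd s).2 Best 0].
Proof.
move=> rs B0; set l' := [:: U; V; Best; Root].
pose wit s' := exists a w : 'I_n,
  [/\ a \notin dead s, w \notin dead s, s'.2 Root 0 = a & s'.2 Best 0 = dist e a w].
(* [Best] starts at 0 without a witness, but a positive value always comes with one. *)
pose J s' := 0 < s'.2 Best 0 -> wit s'.
pose Rl s1 s2 := [/\ agree l' s1 s2, s1.2 Best 0 <= s2.2 Best 0, wit s1 -> wit s2 & J s1 -> J s2].
pose G u v s' := u \notin dead s -> v \notin dead s -> wit s' /\ dist e u v <= s'.2 Best 0.
have Rrefl s1 : Rl s1 s1 by split.
have Rtrans s1 s2 s3 : Rl s1 s2 -> Rl s2 s3 -> Rl s1 s3.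
  move=> [a1 b1 c1 j1] [a2 b2 c2 j2]; split; first exact: agree_trans a2.
  - exact: leq_trans b2.
  - by move=> /c1/c2.
  by move=> /j1/j2.
have Rset b s1 j : b \in [:: U; V] -> Rl s1 (set_arr s1 b 0 j).
  move=> bU; have bl : b \in l' by move: bU; rewrite !inE => /orP[]/eqP ->.
  have nB a : a \in [:: Best; Root] -> (set_arr s1 b 0 j).2 a 0 = s1.2 a 0.
    by rewrite set_arrE; move: bU; rewrite !inE => /orP[]/eqP -> /orP[]/eqP ->.
  have wit_set : wit s1 -> wit (set_arr s1 b 0 j).
    by move=> [a [w [? ? ? ?]]]; exists a, w; rewrite !nB.
  split=> //; [exact: agree_set_arr|by rewrite nB|].
  by move=> J1; rewrite /J nB // => /J1.
have Gst u v s1 s2 : Rl s1 s2 -> G u v s1 -> G u v s2.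
  move=> [_ le w12 _] G1 ua va; have [w1 uv] := G1 ua va; split; first exact: w12.
  exact: leq_trans le.
suff [[ag _ _ _] Guv] : Rl s (arun root_cmd s) /\ forall u v, G u v (arun root_cmd s).
  split=> // u v ua va; have [[a [w [aa wa ra ba]]] uv] := Guv u v ua va.
  by exists a, w.
have [sL _ _] := rs; apply: (@arun_pass n Rl (fun u s' => forall v, G u v s')
  U _ s (dimL sL) Rrefl Rtrans).
- by move=> s1 j; apply: Rset.
- by move=> u s1 s2 R G1 v; apply: Gst R (G1 v).
move=> u s1 R1 u1 _ _; have [ag1 _ _ _] := R1; have r1 := agree_ready ag1 isT isT rs.
have [L1 _ _] := r1.
apply: (@arun_pass n Rl (G u) V _ s1 (dimL L1) Rrefl Rtrans).
- by move=> s2 j; apply: Rset.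
- by move=> v s2 s3; apply: Gst.
move=> v s2 R2 v2 keep2 _; have [ag2 _ _ J12] := Rtrans _ _ _ R1 R2.
have [L2 D2 A2] := agree_ready ag2 isT isT rs.
have u2 : s2.2 U 0 = u by rewrite keep2.
rewrite arun_if !holds_and (holds_alive u2) (holds_alive v2) holds_le.
rewrite (aeval_dist L2 D2 u2 v2) aeval_var (agree_dead ag2 isT).
case: ifPn => [/and3P[ua va le]|nle]; last first.
  split=> // ua va; move: nle; rewrite ua va /= -ltnNge => lt.
  split; last exact: ltnW.
  by apply: J12; [rewrite /J B0|apply: leq_ltn_trans lt].
have dcap : dist e u v < cap n.
  by apply: ltn_cap; have := dist_le_card e u v; rewrite card_ord.
rewrite arun_seq !arun_store aeval_const !aeval_var (aeval_dist L2 D2 u2 v2).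
rewrite -[dim (set_arr _ _ _ _)]/(dim s2) (dimL L2) (modn_small dcap).
rewrite set_arrE u2 modn_small; last by apply: ltn_cap; apply: ltnW.
set s3 := set_arr _ Root _ _.
have s3B : s3.2 Best 0 = dist e u v by rewrite /s3 !set_arrE.
have w3 : wit s3 by exists u, v; split=> //; rewrite /s3 !set_arrE.
split; last by move=> _ _; rewrite s3B.
split; [|by rewrite s3B|by []|by move=> _ _].
by apply: (agree_trans (s2 := set_arr s2 Best 0 (dist e u v))); apply: agree_set_arr.
Qed.

Lemma arun_pos s (a : 'I_n) (M := minn (2 * (2 * C * (10 * C)).+1) n)
    (rank := fun u : 'I_n =>
      #|[pred v : 'I_n | [&& v \notin dead s, v < u & dist e a v == dist e a u]]|) :
  ready s -> s.2 Root 0 = a ->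
  agree [:: U; V; Cnt; Pos] s (arun pos_cmd s) /\
  forall u : 'I_n, (arun pos_cmd s).2 Pos u %% cap n = M * dist e a u + rank u.
Proof.
move=> rs Ra; set l' := [:: U; V; Cnt; Pos].
have [sL _ _] := rs; pose G (u : 'I_n) s' := s'.2 Pos u = M * dist e a u + rank u.
pose Rl s1 s2 := agree l' s1 s2 /\ forall u, G u s1 -> G u s2.
(* Scale, distance and rank are each at most [n], and [n^2 + n < (n + 2)^2]. *)
have small u : M * dist e a u + rank u < cap n.
  have aux (x y z : nat) : x <= n -> y <= n -> z <= n -> x * y + z < cap n.
    by rewrite /cap; clear; nia.
  apply: aux; first exact: geq_minr.
    by have := dist_le_card e a u; rewrite card_ord.
  by rewrite -[X in _ <= X]card_ord max_card.
suff [[ag _] Gu] : Rl s (arun pos_cmd s) /\ forall u, G u (arun pos_cmd s).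
  by split=> // u; rewrite Gu modn_small.
apply: (@arun_pass n Rl G U _ s (dimL sL)).
- by move=> s1; split.
- move=> s1 s2 s3 [a1 g1] [a2 g2]; split=> [|u /g1/g2//]; exact: agree_trans a2.
- by move=> s1 j; split; first exact: agree_set_arr.
- by move=> u s1 s2 [_ g]; apply: g.
move=> u s1 [ag1 _] u1 _ _; have r1 := agree_ready ag1 isT isT rs.
have [L1 D1 A1] := r1; rewrite arun_seq.
have [|ag2 c2] := @arun_count n Cnt V rank_expr s1
  [pred v : 'I_n | [&& v \notin dead s, v < u & dist e a v == dist e a u]] (dimL L1) isT.
  move=> v s' ag v'; have [L' D' _] := agree_ready ag isT isT r1.
  have u' : s'.2 U 0 = u by rewrite (agree_arr ag).
  have a' : s'.2 Root 0 = a by rewrite (agree_arr ag) // (agree_arr ag1).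
  rewrite !holds_and (holds_alive v') holds_lt !holds_le !aeval_var u' v'.
  rewrite (aeval_dist L' D' a' v') (aeval_dist L' D' a' u') -eqn_leq.
  by rewrite (agree_dead ag isT) (agree_dead ag1 isT).
set s2 := arun _ s1 in ag2 c2 *; clearbody s2.
have [L2 D2 A2] := agree_ready ag2 isT isT r1.
have u2 : s2.2 U 0 = u by rewrite (agree_arr ag2).
have a2 : s2.2 Root 0 = a by rewrite (agree_arr ag2) // (agree_arr ag1).
have val2 : aeval s2 (AAdd (AMul scale_expr (dist_expr Root U)) (var Cnt))
    = M * dist e a u + rank u.
  rewrite aeval_add aeval_var c2; congr (_ * _ + _); last exact: aeval_dist.
  rewrite -[LHS]/(aeval s2 size_expr - (aeval s2 size_expr - aeval s2 density_expr)).
  by rewrite aeval_size (aeval_density L2) (dimL L2) /M minnC minnE.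
rewrite arun_store val2 aeval_var u2 (dimL L2) (modn_small (small u)).
split; last by rewrite /G set_arrE !eqxx.
split; first by apply: agree_trans (agree_sub _ ag2) (agree_set_arr _ _ _ _); first exact/allP.
move=> v Gv; rewrite /G set_arrE eqxx /=; case: (eqVneq (v : nat) u) => [/val_inj -> //|_].
by rewrite (agree_arr ag2).
Qed.

Lemma arun_flag s : s.1 = L -> s.2 Flag 0 = 0 ->
  agree [:: Cnt; V; Flag] s (arun flag_cmd s) /\
  (arun flag_cmd s).2 Flag 0 = (#|dead s| <= 63 * C ^ 2 * L 1).
Proof.
move=> sL F0; rewrite arun_seq.
have [|ag c] := @arun_count n Cnt V (AArr Dead (var V)) s (mem (dead s)) (dimL sL) isT.
  move=> v s' ag v'; rewrite /holds aeval_arr aeval_var v' (agree_arr ag) //.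
  by rewrite /= inE.
set s1 := arun _ s in ag c *; clearbody s1.
have L1 : s1.1 = L by rewrite ag.1.
have F1 : s1.2 Flag 0 = 0 by rewrite (agree_arr ag).
rewrite arun_if holds_le aeval_var c.
have -> : aeval s1 (AMul (AConst 63) (AMul (AMul c_expr c_expr) (ALow (AConst 1))))
    = 63 * C ^ 2 * L 1.
  rewrite -[LHS]/(63 * (aeval s1 c_expr * aeval s1 c_expr * s1.1 (minn 1 _))).
  by rewrite aeval_c // minn_low_max // L1 mulnn mulnA.
case: ifP => _; last by split; [apply: agree_sub ag; apply/allP|].
rewrite arun_store !aeval_const modn_small; last by rewrite /cap; nia.
split; last by rewrite set_arrE !eqxx.
by apply: agree_trans (agree_sub _ ag) (agree_set_arr _ _ _ _); first exact/allP.
Qed.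

Lemma arun_AOut s x y : arun (AOut y x) s =
  if 0 < aeval s y <= low_max (dim s) then set_low s (aeval s y) (aeval s x %% cap (dim s))
  else s.
Proof. by []. Qed.

Lemma arun_out_cell s k x (u : 'I_n) : dim s = n -> s.2 U 0 = u -> 0 < k <= 4 ->
  arun (AOut (out_cell k) x) s = set_low s (k + 4 * u) (aeval s x %% cap n).
Proof.
move=> dn u0 /andP[k0 k4].
have E : aeval s (out_cell k) = k + 4 * u by rewrite /out_cell /= u0.
rewrite arun_AOut E dn ifT // /low_max addn_gt0 k0 /=.
have : 4 * n <= 4 + n * n by case: (n) => [|[|m]] //; clear; nia.
by have := ltn_ord u; move: k4; clear; lia.
Qed.

Lemma arun_out s (s' := arun out_cmd s) : s.1 = L ->
  [/\ agree [:: U] (s'.1, s.2) s', s'.1 0 = n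
    & forall u : 'I_n, [/\ s'.1 (1 + 4 * u) = (u \in dead s),
        s'.1 (2 + 4 * u) = s.2 Pos u %% cap n, s'.1 (3 + 4 * u) = 0 & s'.1 (4 + 4 * u) = 1]].
Proof.
move=> sL; pose I k s' := [/\ forall b, b != U -> s'.2 b = s.2 b, dim s' = n
  & forall u : 'I_n, u < k -> [/\ s'.1 (1 + 4 * u) = (u \in dead s),
        s'.1 (2 + 4 * u) = s.2 Pos u %% cap n, s'.1 (3 + 4 * u) = 0 & s'.1 (4 + 4 * u) = 1]].
suff [keep d out] : I n s'.
  split=> // [|u]; last exact: out.
  by split=> // b; rewrite inE => /keep.
apply: (arun_for (dimL sL)) => //.
- by split=> //; rewrite dimL.
- move=> k s1 [keep1 d1 out1] j; split=> // b bU.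
  by apply/funext => i; rewrite set_arrE (negPf bU) keep1.
move=> u s1 [keep1 d1 out1] u1; rewrite !arun_seq.
rewrite (arun_out_cell _ d1 u1) //; set s2 := set_low _ _ _.
have d2 : dim s2 = n by rewrite -d1 /dim /= /update ltn_eqF.
rewrite (arun_out_cell _ d2 u1) //; set s3 := set_low _ _ _.
have d3 : dim s3 = n by rewrite -d2 /dim /= /update ltn_eqF.
rewrite (arun_out_cell _ d3 u1) //; set s4 := set_low _ _ _.
have d4 : dim s4 = n by rewrite -d3 /dim /= /update ltn_eqF.
rewrite (arun_out_cell _ d4 u1) //; set s5 := set_low _ _ _.
have d5 : dim s5 = n by rewrite -d4 /dim /= /update ltn_eqF.
have n0 : 0 < n by apply: leq_ltn_trans (ltn_ord u).
have v1 : aeval s1 (not_expr (alive_expr U)) %% cap n = (u \in dead s).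
  rewrite -[aeval _ _]/(1 - (1 - s1.2 Dead (s1.2 U 0))) u1 keep1 // inE.
  by case: (s.2 Dead u) => [|m]; rewrite ?mod0n // subn0 modn_small // /cap; nia.
have v2 : aeval s2 (AArr Pos (var U)) %% cap n = s.2 Pos u %% cap n.
  by rewrite aeval_arr aeval_var /= u1 keep1.
have v4 : aeval s4 (AConst 1) %% cap n = 1 by rewrite modn_small // /cap; nia.
have v3 : aeval s3 (AConst 0) %% cap n = 0 by rewrite mod0n.
have setE t k w i : (set_low t k w).1 i = if i == k then w else t.1 i by [].
have low i : s5.1 i = if i == 4 + 4 * u then 1 else if i == 3 + 4 * u then 0 else
   if i == 2 + 4 * u then s.2 Pos u %% cap n else if i == 1 + 4 * u then (u \in dead s) : nat else s1.1 i.
  by rewrite /s5 setE v4 {1}/s4 setE v3 {1}/s3 setE v2 {1}/s2 setE v1.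
split=> // v; rewrite ltnS leq_eqVlt => /orP[/eqP/val_inj -> |vu].
  by split; rewrite low !eqn_add2r.
have cell_neq k j : 0 < k <= 4 -> 0 < j <= 4 -> (k + 4 * v == j + 4 * u) = false.
  by move: (nat_of_ord v) (nat_of_ord u) vu; clear; lia.
have [c1 c2 c3 c4] := out1 v vu.
by split; rewrite low !cell_neq.
Qed.

End Program.

Fixpoint quiet (p : acmd) : bool :=
  match p with
  | ASkip | AStore _ _ _ => true
  | AOut _ _ => false
  | ASeq p q | AIf _ p q => quiet p && quiet q
  | AFor _ p => quiet p
  end.

Lemma arun_quiet p (s : astate) : quiet p -> (arun p s).1 = s.1.
Proof.
elim: p s => //= [p IHp q IHq|x p IHp q IHq|a p IHp] s.
- by case/andP=> /IHp Ep /IHq Eq; rewrite Eq Ep.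
- by case/andP=> /IHp Ep /IHq Eq; case: ifP.
by move=> /IHp Ep; move: (iota 0 _) => r; elim: r s => //= i r IHr s; rewrite IHr Ep.
Qed.

Lemma arun_seqs (ps : seq acmd) s :
  arun (foldr ASeq ASkip ps) s = foldl (fun s p => arun p s) s ps.
Proof. by elim: ps s => //= p ps IHps s. Qed.

Section Correctness.
Variables (n : nat) (e : rel 'I_n) (L : nat -> nat).
Hypotheses (L0 : L 0 = n) (Ladj : forall i j : 'I_n, L (4 + (i * n + j)) = e i j).
Let C := (L 2 + L 3 - 1) %/ L 3.
Let M := minn (2 * (2 * C * (10 * C)).+1) n.

(** The last clause is conditional on live vertices because no root exists when everything has been
    deleted. *)
Lemma arun_algorithm (s := arun algorithm (input_state L)) :
  exists (Z : {set 'I_n}) (pos : 'I_n -> nat),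
  [/\ s.1 0 = n /\ s.2 Flag 0 = (#|Z| <= 63 * C ^ 2 * L 1),
      forall u : 'I_n, [/\ s.1 (1 + 4 * u) = (u \in Z), s.1 (2 + 4 * u) = pos u,
        s.1 (3 + 4 * u) = 0 & s.1 (4 + 4 * u) = 1],
      [/\ {in ~: Z &, forall u v, connect e u v}%SET,
          {in ~: Z & &, forall x y z, ~~ asteroidal e C x y z}%SET
        & forall u, #|~: Z :&: dball e u (10 * C)|%SET <= 2 * (2 * C * (10 * C)).+1],
      forall Q : {set 'I_n}, transversal e C Q -> #|Z| <= 3 * #|Q|
    & forall u v, u \notin Z -> v \notin Z -> exists a w : 'I_n,
      [/\ a \notin Z, w \notin Z, {in ~: Z &, forall x y, dist e x y <= dist e a w}%SET
        & forall x, pos x = M * dist e a x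
            + #|[pred y : 'I_n | [&& y \notin Z, y < x & dist e a y == dist e a x]]|]].
Proof.
rewrite {}/s arun_seqs.
rewrite [foldl _ _ _]/foldl.
have [ag1 D1] := arun_dist L0 Ladj; set s1 := arun dist_cmd _ in ag1 D1 *.
have L1 : s1.1 = L by rewrite ag1.1.
have [ag2 A2] := arun_avoid L0 Ladj L1 D1.
have k2 b : b \in [:: Dead; Best; Flag] -> (arun avoid_cmd s1).2 b = fun=> 0.
  by rewrite !inE => /or3P[]/eqP ->; rewrite !arun_keeps.
set s2 := arun avoid_cmd s1 in ag2 A2 k2 *; clearbody s2.
have r2 : ready e L s2.
  by split=> //; [rewrite ag2.1|move=> u v; rewrite (agree_arr ag2)].
have d2 : dead n s2 = finset.set0 by apply/setP => v; rewrite !inE k2.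
have t2 : thrifty e L s2 by move=> Q _; rewrite d2 cards0.
have [p3 c3] := arun_connect L0 r2; set s3 := arun connect_cmd s2 in p3 c3 *.
have k3 b : b \in [:: Best; Flag] -> s3.2 b = s2.2 b.
  by rewrite !inE => /orP[]/eqP ->; rewrite arun_keeps.
clearbody s3; have r3 := prunes_ready p3 r2.
have [p4 c4] := arun_asteroidal L0 r3; set s4 := arun asteroidal_cmd s3 in p4 c4 *.
have k4 b : b \in [:: Best; Flag] -> s4.2 b = s2.2 b.
  by move=> bl; rewrite -k3 //; move: bl; rewrite !inE => /orP[]/eqP ->; rewrite arun_keeps.
clearbody s4; have r4 := prunes_ready p4 r3.
have [p5 c5] := arun_density L0 r4; set s5 := arun density_cmd s4 in p5 c5 *.
have k5 b : b \in [:: Best; Flag] -> s5.2 b = s2.2 b.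
  by move=> bl; rewrite -k4 //; move: bl; rewrite !inE => /orP[]/eqP ->; rewrite arun_keeps.
clearbody s5; have r5 := prunes_ready p5 r4.
have [_ /fintype.subsetP d34 t3] := p3; have [_ /fintype.subsetP d45 t4] := p4.
have [_ /fintype.subsetP d56 t5] := p5.
have B5 : s5.2 Best 0 = 0 by rewrite k5 ?k2.
have [ag6 w6] := arun_root L0 r5 B5; set s6 := arun root_cmd s5 in ag6 w6 *; clearbody s6.
have r6 := agree_ready ag6 isT isT r5; have d6 := agree_dead n ag6 isT.
set Z := dead n s5 in w6 d6.
have k7 b : b \in [:: Dead; Flag] -> (arun pos_cmd s6).2 b = s6.2 b.
  by rewrite !inE => /orP[]/eqP ->; rewrite arun_keeps.
have low7 : (arun pos_cmd s6).1 = L.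
  by have [L6 _ _] := r6; rewrite arun_quiet.
have pos7 := arun_pos L0 r6; set s7 := arun pos_cmd s6 in k7 low7 pos7 *; clearbody s7.
have d7 : dead n s7 = Z by rewrite -d6; apply: dead_eq; rewrite k7.
have F7 : s7.2 Flag 0 = 0 by rewrite k7 // (agree_arr ag6) // k5 // k2.
have [ag8 F8] := arun_flag L0 low7 F7.
have k8 : (arun flag_cmd s7).2 Pos = s7.2 Pos by rewrite arun_keeps.
set s8 := arun flag_cmd s7 in ag8 F8 k8 *; clearbody s8.
have low8 : s8.1 = L by rewrite ag8.1.
have d8 : dead n s8 = Z by rewrite -d7; apply: agree_dead ag8 isT.
have [ag9 n9 out9] := arun_out L0 low8.
have F9 : (arun out_cmd s8).2 Flag = s8.2 Flag by rewrite arun_keeps.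
exists Z, (fun u => s7.2 Pos u %% cap n); split.
- by rewrite n9 F9 F8 d7.
- by move=> u; have := out9 u; rewrite d8 k8.
- split=> //.
  + move=> u v; rewrite !finset.in_setC => uZ vZ; apply: c3; rewrite finset.in_setC.
      by apply: contra uZ => /d45/d56.
    by apply: contra vZ => /d45/d56.
  move=> x y z; rewrite !finset.in_setC => xZ yZ zZ.
  by apply: c4; rewrite finset.in_setC; [apply: contra xZ|apply: contra yZ|apply: contra zZ]; apply: d56.
- move=> Q tQ; have := t5 (t4 (t3 t2)) Q tQ; rewrite -/Z => th.
  by apply: leq_trans th _; rewrite leq_mul2l subset_leq_card ?finset.subsetIl.
move=> u v uZ vZ; have [a [w [aZ wZ Ra Baw _]]] := w6 u v uZ vZ.
exists a, w; split=> //.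
  move=> x y; rewrite !finset.in_setC => xZ yZ.
  by have [? [? [_ _ _ _]]] := w6 x y xZ yZ; rewrite Baw.
by have [_ pE] := pos7 a Ra; move=> x; rewrite pE d6.
Qed.

End Correctness.

(** If the heights differ by [t + 1], the positions differ by at least [M t + 1] and less than
    [M (t + 2)], while [t + 1 <= d <= E + t + 1]. At equal heights the ranks separate the positions
    and [d <= E]. *)
Lemma position_bounds (hu hv ru rv d M E : nat) :
  ru < M -> rv < M -> (hu = hv -> ru <> rv) ->
  hu <= hv + d -> hv <= hu + d -> 0 < d -> d + minn hu hv <= maxn hu hv + E ->
  let pu := M * hu + ru in let pv := M * hv + rv in
  (pu - pv) + (pv - pu) <= 2 * M * d /\ d <= E.+1 * ((pu - pv) + (pv - pu)).
Proof.
move=> ruM rvM neq d1 d2 d0 dE pu pv.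
have key x y (rx ry : nat) : rx < M -> ry < M -> x < y -> y <= x + d -> d + x <= y + E ->
    let px := M * x + rx in let py := M * y + ry in
    (px - py) + (py - px) <= 2 * M * d /\ d <= E.+1 * ((px - py) + (py - px)).
  move=> rxM ryM xy yd dyE px py.
  have [t yt] : exists t, y = x + t.+1 by exists (y - x).-1; lia.
  have pE : py = M * x + M * t + M + ry by rewrite /py yt; nia.
  have tM : t <= M * t by rewrite leq_pmull //; lia.
  have Mt : M * t + M <= M * d by rewrite -mulnSr leq_mul2l; lia.
  have pxy : (px - py) + (py - px) = M * t + M + ry - rx by rewrite pE /px; lia.
  rewrite pxy; split; first by rewrite -mulnA; lia.
  apply: (@leq_trans (E.+1 * t.+1)); first by rewrite yt in dyE; nia.
  by rewrite leq_mul2l; apply/orP; right; lia.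
have [huv|hvu|huv] := ltngtP hu hv.
- by apply: key => //; lia.
- rewrite addnC; apply: key => //; lia.
have := neq huv; rewrite /pu /pv huv !subnDl => rneq; split.
  apply: (@leq_trans M); first by clear - ruM rvM; lia.
  by rewrite -mulnA mulnC -mulnA leq_pmulr // muln_gt0 d0.
have dle : d <= E by rewrite huv minnn maxnn addnC leq_add2l in dE.
apply: (@leq_trans (E.+1 * 1)); first by rewrite muln1 ltnW.
by rewrite leq_mul2l /=; clear - rneq; lia.
Qed.

(** * The embedding by scaled levels and ranks *)

Section Embedding.
Variables (R : realType) (n : nat) (e : rel 'I_n) (C : nat) (Z : {set 'I_n}).
Hypothesis e_sym : symmetric e.
Hypothesis Z_conn : {in ~: Z &, forall u v, connect e u v}%SET.
Hypothesis Z_ast : {in ~: Z & &, forall x y z, ~~ asteroidal e C x y z}%SET.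
Hypothesis Z_dens : forall u,
  #|~: Z :&: dball e u (10 * C)|%SET <= 2 * (2 * C * (10 * C)).+1.
Let M := minn (2 * (2 * C * (10 * C)).+1) n.
Let rank (a u : 'I_n) :=
  #|[pred v : 'I_n | [&& v \notin Z, v < u & dist e a v == dist e a u]]|.

Variable pos : 'I_n -> nat.
Hypothesis posP : forall u v, u \notin Z -> v \notin Z -> exists a w : 'I_n,
  [/\ a \notin Z, w \notin Z, {in ~: Z &, forall x y, dist e x y <= dist e a w}%SET
    & forall x, pos x = M * dist e a x + rank a x].

Lemma pos_bounds (u v : 'I_n) : u \notin Z -> v \notin Z -> u != v ->
  (pos u - pos v) + (pos v - pos u) <= 2 * M * dist e u v /\
  dist e u v <= (10 * C).+1 * ((pos u - pos v) + (pos v - pos u)).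
Proof.
move=> uZ vZ uv; have [a [w [aZ wZ diam posE]]] := posP uZ vZ.
have inZ x : x \notin Z -> (x \in ~: Z)%SET by rewrite inE.
have coord : {in ~: Z &, forall y z, dist e y z + minn (dist e a y) (dist e a z)
    <= maxn (dist e a y) (dist e a z) + 10 * C}%SET.
  by apply: (dist_coordinate e_sym Z_conn Z_ast (inZ _ aZ) (inZ _ wZ)).
(* By [coord] the level of [x] lies in the ball of radius 10 C about [x], whose size [Z_dens]
   bounds. The inequality is strict because [x] does not count itself. *)
have rank_lt x : x \notin Z -> rank a x < M.
  move=> xZ; pose lvl := [set y | (y \notin Z) && (dist e a y == dist e a x)]%SET.
  have lt : rank a x < #|lvl|.
    rewrite /rank -[X in X < _]cardsE proper_card //; apply/properP; split.
      by apply/fintype.subsetP=> y; rewrite !inE => /and3P[-> _ ->].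
    by exists x; rewrite !inE ?xZ ?eqxx ?ltnn ?andbF.
  rewrite /M leq_min; apply/andP; split; apply: leq_trans lt _; last first.
    by rewrite -[X in _ <= X]card_ord max_card.
  apply: leq_trans (Z_dens x); apply: subset_leq_card; apply/fintype.subsetP=> y.
  rewrite !inE => /andP[yZ /eqP yx]; rewrite yZ /=.
  by have := coord x y (inZ _ xZ) (inZ _ yZ); rewrite yx minnn maxnn addnC leq_add2l.
rewrite !posE; apply: (@position_bounds _ _ _ _ _ _ (10 * C)).
- exact: rank_lt.
- exact: rank_lt.
- have lt_rank x y : x \notin Z -> dist e a x = dist e a y -> x < y -> rank a x < rank a y.
    move=> xZ xy lt; rewrite /rank -[X in X < _]cardsE -[X in _ < X]cardsE proper_card //; apply/properP; split.
      apply/fintype.subsetP=> z; rewrite !inE => /and3P[-> zx /eqP ->].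
      by rewrite xy eqxx (ltn_trans zx lt).
    by exists x; rewrite !inE xZ ?lt ?xy ?eqxx ?ltnn.
  move=> huv reqv; have [lt|lt|/val_inj euv] := ltngtP u v.
  + by have := lt_rank _ _ uZ huv lt; rewrite reqv ltnn.
  + by have := lt_rank _ _ vZ (esym huv) lt; rewrite reqv ltnn.
  by rewrite euv eqxx in uv.
- by rewrite (dist_sym e_sym u v); apply: dist_triangle.
- exact: dist_triangle.
- exact: dist_gt0.
exact: coord (inZ _ uZ) (inZ _ vZ).
Qed.

Local Open Scope ring_scope.

Lemma natr_dist (p q : nat) : `|p%:R - q%:R| = ((p - q) + (q - p))%N%:R :> R.
Proof.
have [pq|/ltnW qp] := leqP p q.
  by rewrite distrC -natrB // ger0_norm ?ler0n // (eqP pq).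
by rewrite -natrB // ger0_norm ?ler0n // (eqP qp) addn0.
Qed.

Lemma pos_outlier_embedding (k : R) : #|Z|%:R <= k ->
  outlier_embedding e k ((2 * M)%:R * (10 * C).+1%:R) Z (fun u => (pos u)%:R).
Proof.
move=> Zk; apply: outlier_embedding_intro; rewrite ?ler0n //.
  move=> u v; rewrite !finset.in_setC => uZ vZ; rewrite natr_dist -natrM ler_nat.
  have [->|uv] := eqVneq u v; first by rewrite subnn.
  by have [] := pos_bounds uZ vZ uv.
move=> u v; rewrite !finset.in_setC => uZ vZ; rewrite natr_dist -natrM ler_nat.
have [->|uv] := eqVneq u v; first by rewrite distxx.
by have [] := pos_bounds uZ vZ uv.
Qed.

End Embedding.

(** * Input encoding and running time *)

Section Input.
Variables (n : nat) (e : rel 'I_n) (k : nat) (c : rat).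
Let inp := input e k c.

Lemma nth_allpairs_ord (i j : 'I_n) :
  nth 0 [seq nat_of_bool (e i j) | i <- enum 'I_n, j <- enum 'I_n] (i * n + j) = e i j.
Proof.
have gen (s : seq 'I_n) (m : nat) : m < size s ->
    nth 0 [seq nat_of_bool (e i j) | i <- s, j <- enum 'I_n] (m * n + j)
    = e (nth i s m) j.
  elim: s m => [//|x s IHs] [|m] ms; rewrite allpairs_cons nth_cat size_map size_enum_ord.
    by rewrite mul0n add0n ltn_ord (nth_map j) ?size_enum_ord ?nth_ord_enum.
  by rewrite mulSn -addnA ltnNge leq_addr /= addKn IHs.
by rewrite gen ?size_enum_ord ?nth_ord_enum.
Qed.

Lemma memory_input_adj (i j : 'I_n) : memory_of inp (4 + (i * n + j)) = e i j.
Proof. by rewrite /memory_of /inp /input nth_cat ltnNge leq_addr /= addKn nth_allpairs_ord. Qed.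

Lemma size_input : size inp = 4 + n * n.
Proof. by rewrite size_cat size_allpairs size_enum_ord. Qed.

Lemma memory_of_input_state :
  memory_of_state (input_state (memory_of inp)) = memory_of inp.
Proof.
apply/funext => b; rewrite /memory_of_state /=; case: leqP => // lb.
by rewrite /memory_of nth_default // size_input; apply: ltnW.
Qed.

Lemma leq_sumn (s : seq nat) i : i < size s -> nth 0 s i <= sumn s.
Proof.
elim: s i => // x s IHs [|i] /= lt; first exact: leq_addr.
by apply: leq_trans (IHs i lt) (leq_addl _ _).
Qed.

Lemma memory_input_lt i : memory_of inp i < 2 ^ bitsize inp.
Proof.
rewrite /memory_of; have [ls|lt] := leqP (size inp) i.
  by rewrite nth_default // expn_gt0.
apply: leq_trans (bits_lt _) _; rewrite leq_exp2l //.
by rewrite -(nth_map 0 0 bits) // /bitsize leq_sumn ?size_map.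
Qed.

Lemma size_le_bitsize (s : seq nat) : size s <= bitsize s.
Proof. by elim: s => //= x s IHs; rewrite /bitsize /= -add1n leq_add. Qed.

Lemma dim_lt_bitsize : n < bitsize inp.
Proof.
apply: leq_trans (size_le_bitsize _); rewrite size_input.
by case: (n) => [|m] //; nia.
Qed.

End Input.

Definition program : cmd :=
  Seq (compile algorithm)
      (Store (Const 0) (Read (addr_expr Flag (Const 0)))).

Lemma wf_algorithm : wf algorithm. Proof. by []. Qed.

Definition program_time_factor : nat :=
  time_factor algorithm +
  (cost_factor (Const 0) + cost_factor (Read (addr_expr Flag (Const 0)))).

Lemma exec_program n (e : rel 'I_n) k c
    (s := arun algorithm (input_state (memory_of (input e k c)))) :
  exists t, exec program (memory_of (input e k c)) t
              (update (memory_of_state s) 0 (s.2 Flag 0)) /\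
    t <= (program_time_factor * 5) * bitsize (input e k c) ^ (loop_depth algorithm).+1.
Proof.
(* [V] dominates both the input cells, which are below [2 ^ B], and [cap n], which is at most
   [(2 ^ B)^2] since [n < B]. *)
set inp := input e k c; set B := bitsize inp; set V := 2 ^ (2 * B).+1.
have nB : n < B := dim_lt_bitsize e k c.
have V_gt1 : 1 < V by rewrite -[1](expn0 2) ltn_exp2l.
pose s0 := input_state (memory_of inp).
have ds : dim s0 = n by [].
have capV : cap n <= V.
  have : n.+2 <= 2 ^ B by apply: leq_ltn_trans nB (ltn_expl _ _).
  move=> h; apply: leq_trans (leq_mul h h) _.
  by rewrite /V expnS [2 * B]mulnC expnM -mulnn leq_pmull.
have bs : bounded V s0.
  split=> [b|//]; apply: ltnW; apply: leq_trans (memory_input_lt _ _ _ _) _.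
  by rewrite leq_exp2l // -/inp -/B; lia.
have [t et lt] := exec_compile (s := s0) V_gt1 wf_algorithm capV bs.
have bs1 : bounded V s := bounded_arun (s := s0) algorithm capV bs.
have bV : bits V <= 5 * B by apply: bits_le; [lia|rewrite ltn_exp2l //; lia].
set t1 := cost (memory_of_state s) (Const 0)
  + cost (memory_of_state s) (Read (addr_expr Flag (Const 0))).
have lt1 : t1 <= (cost_factor (Const 0) + cost_factor (Read (addr_expr Flag (Const 0)))) * bits V.
  by rewrite mulnDl leq_add //; apply: cost_le => // b; apply: bounded_memory.
exists (t + t1); split.
  apply: exec_seq; first by rewrite -memory_of_input_state; exact: et.
  have -> : update (memory_of_state s) 0 (s.2 Flag 0)
     = update (memory_of_state s) (eval (memory_of_state s) (Const 0))
         (eval (memory_of_state s) (Read (addr_expr Flag (Const 0)))).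
    congr (update _ _ _).
    exact/esym/(@eval_compile s (AArr Flag (AConst 0))).
  exact: exec_store.
apply: leq_trans (leq_add lt lt1) _; rewrite ds.
have P1 : 0 < n.+1 ^ loop_depth algorithm by rewrite expn_gt0.
have PB : n.+1 ^ loop_depth algorithm <= B ^ loop_depth algorithm.
  by case: (loop_depth algorithm) => // m; rewrite leq_exp2r.
have arith TA TB b P : 0 < P -> TA * b * P + TB * b <= (TA + TB) * b * P.
  by move=> P0; rewrite !mulnDl leq_add // leq_pmulr.
apply: leq_trans (arith _ _ _ _ P1) _.
have arith2 T b P Q : b <= 5 * B -> P <= Q -> T * b * P <= T * 5 * (B * Q).
  by move=> bB PQ; rewrite mulnA -[T * 5 * B]mulnA leq_mul // leq_mul2l bB orbT.
by rewrite expnS; apply: arith2.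
Qed.

(** For [n <= 1] the logarithm makes the outlier bound of the theorem 0, so nothing may be deleted;
    comparison with the empty transversal guarantees this. *)
Lemma transversal_small n (e : rel 'I_n) C : n <= 1 -> transversal e C finset.set0.
Proof.
move=> n1; have eq_ord (u v : 'I_n) : u = v.
  by apply: val_inj; move: (ltn_ord u) (ltn_ord v) n1; rewrite /=; lia.
split.
- by move=> u v _ _; rewrite (eq_ord u v) connect0.
- move=> x y z _ _ _; apply/negP=> /and3P[/and3P[]].
  by rewrite (eq_ord y x) distxx.
move=> u r; apply: leq_trans (max_card _) _; rewrite card_ord.
exact: leq_trans n1 _.
Qed.

Local Open Scope ring_scope.

(** A c-embedding is a C-embedding, and rounding up at most doubles [c >= 1], so powers of [C] cost
    only constants. *)
Lemma ceil_div_bounds (R : realType) (c : rat)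
    (C := ((`|numq c| + `|denq c| - 1) %/ `|denq c|)%N) :
  1 <= c -> [/\ (0 < C)%N, ratr c <= C%:R :> R & C%:R <= 2 * ratr c :> R].
Proof.
move=> c1; have d0 : (0 < `|denq c|)%N by rewrite absz_gt0 denq_neq0.
have c0 : 0 < c := lt_le_trans ltr01 c1.
have cE : ratr c = `|numq c|%:R / `|denq c|%:R :> R.
  by rewrite /ratr !natr_absz !ger0_norm ?denq_ge0 // numq_ge0 ltW.
have nd : (`|denq c| <= `|numq c|)%N.
  have : (1 : R) <= ratr c by rewrite -[1](ratr_nat R 1) ler_rat.
  by rewrite cE ler_pdivlMr ?ltr0n // mul1r ler_nat.
have C1 : (C * `|denq c| <= `|numq c| + `|denq c| - 1)%N := leq_trunc_div _ _.
have C2 : (`|numq c| + `|denq c| - 1 < C.+1 * `|denq c|)%N := ltn_ceil _ d0.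
have Cge : (`|numq c| <= C * `|denq c|)%N by rewrite mulSn in C2; lia.
split.
- by rewrite lt0n; apply: contraTneq Cge => ->; lia.
- by rewrite cE ler_pdivrMr ?ltr0n // -natrM ler_nat.
rewrite cE mulrA ler_pdivlMr ?ltr0n // -!natrM ler_nat; lia.
Qed.

Theorem theorem1p1 (R : realType) :
  exists (p : cmd) (a d : nat) (A B : R),
    forall (n : nat) (e : rel 'I_n) (k : nat) (c : rat),
      symmetric e -> 1 <= c ->
      exists (t : nat) (M : memory),
        [/\ exec p (memory_of (input e k c)) t M,
            (t <= a * bitsize (input e k c) ^ d)%N
          & if says_no M
            then ~ admits_outlier_embedding e (k%:R : R) (ratr c)
            else outlier_embedding e
                   (A * ratr c ^+ 6 * k%:R * (ln n%:R) `^ (5 / 2))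
                   (B * ratr c ^+ 13)
                   (output_outliers n M) (@output_map R n M)].
Proof.
(* Normalises the logarithmic factor, which is at least [l2] once [n >= 2]. *)
pose l2 : R := (ln 2) `^ (5 / 2).
have l2_gt0 : 0 < l2 by rewrite powR_gt0 // ln_gt0 // ltr1n.
exists program, (program_time_factor * 5)%N, (loop_depth algorithm).+1, (252 / l2), 7392.
move=> n e k c e_sym c1; have [t [Ep tle]] := exec_program e k c.
set L := memory_of (input e k c) in Ep *.
exists t, (update (memory_of_state (arun algorithm (input_state L))) 0 ((arun algorithm (input_state L)).2 Flag 0)).
split; [exact: Ep|exact: tle|].
have L0 : L 0%N = n by [].
have Ladj (i j : 'I_n) : L (4 + (i * n + j))%N = e i j := memory_input_adj e k c i j.
have := arun_algorithm L0 Ladj; set s := arun algorithm _.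
have [C_gt0 cC C2c] := ceil_div_bounds R c1.
rewrite -[((L 2 + L 3 - 1) %/ L 3)%N]/((`|numq c| + `|denq c| - 1) %/ `|denq c|)%N.
set C := ((_ + _ - 1) %/ _)%N in C_gt0 cC C2c *.
rewrite -[L 1%N]/k.
move=> [Z [pos [[s0 Fs] out [conn ast dens] thr posP]]].
clearbody s.
have c_ge1 : 1 <= ratr c :> R by rewrite -[1](ratr_nat R 1) ler_rat.
have c_ge0 : 0 <= ratr c :> R := le_trans ler01 c_ge1.
rewrite /says_no /update eqxx Fs.
case: (leqP #|Z| (63 * C ^ 2 * k)) => [Zle|Zgt] /=; last first.
  (* An embedding would give a transversal of size at most [21 C^2 k], hence at most [63 C^2 k]
     deletions, against the flag. *)
  move=> [K [f emb]]; have [Kk conn' _ _] := emb.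
  have [g [g_exp g_lip]] := outlier_embedding_scaled emb.
  have [|Q Qle tQ] := line_transversal e_sym C_gt0 conn' g_exp.
    move=> u v uK vK; apply: le_trans (g_lip u v uK vK) _.
    by rewrite ler_wpM2r.
  have := thr Q tQ; rewrite ler_nat in Kk.
  move: Zgt Qle Kk; move: (C ^ 2)%N #|Z| #|Q| #|K| => C' z q m; clear; nia.
have cell (v : 'I_n) j : (0 < j <= 4)%N -> (0 < j + 4 * v <= low_max (dim s))%N.
  move=> /andP[j0 j4]; rewrite addn_gt0 j0 /low_max /dim s0 /=.
  have : (4 * n <= 4 + n * n)%N by case: (n) => [|[|m]] //; clear; nia.
  by have := ltn_ord v; move: j4; clear; lia.
set M := (fun b => _); have low i : (0 < i <= low_max (dim s))%N -> M i = s.1 i.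
  by move=> /andP[i0 il]; rewrite /M gtn_eqF // memory_of_state_low.
have -> : output_outliers n M = Z.
  by apply/setP => v; rewrite inE low ?cell //; case: (out v) => -> _ _ _; case: (_ \in _).
have -> : @output_map R n M = fun u => (pos u)%:R.
  apply/funext => v; rewrite /output_map !low ?cell //.
  by case: (out v) => _ -> -> ->; rewrite subr0 divr1.
move: (ratr c : R) cC C2c c_ge1 c_ge0 => x cC C2c c_ge1 c_ge0.
have Zk : #|Z|%:R <= 252 / l2 * x ^+ 6 * k%:R * (ln n%:R) `^ (5 / 2) :> R.
  have [n1|n2] := leqP n 1.
    have := thr _ (transversal_small e C n1); rewrite cards0 muln0 leqn0 => /eqP ->.
    by rewrite !mulr_ge0 ?powR_ge0 ?exprn_ge0 ?invr_ge0 ?(ltW l2_gt0) //.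
  have ln_le : l2 <= (ln n%:R) `^ (5 / 2).
    by apply: ge0_ler_powR; rewrite ?nnegrE ?ln_ge0 ?ler1n ?(ltnW n2) // ler_ln ?posrE ?ltr0n ?ler_nat // ltnW.
  have Zle' : #|Z|%:R <= 63 * (4 * x ^+ 2) * k%:R :> R.
    apply: (@le_trans _ _ (63 * C%:R ^+ 2 * k%:R)).
      by rewrite -natrX -!natrM ler_nat.
    rewrite ler_wpM2r // ler_wpM2l //.
    have -> : 4 * x ^+ 2 = (2 * x) ^+ 2 :> R by ring.
    by rewrite ler_pXn2r // nnegrE ?ler0n // mulr_ge0.
  apply: le_trans Zle' _.
  have -> : 252 / l2 * x ^+ 6 * k%:R * ln n%:R `^ (5 / 2)
      = 252 * x ^+ 6 * k%:R * (ln n%:R `^ (5 / 2) / l2) by rewrite -!mulrA; ring.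
  apply: (@le_trans _ _ (252 * x ^+ 6 * k%:R)).
    rewrite ler_wpM2r // mulrA -natrM ler_wpM2l //.
    by rewrite ler_weXn2l.
  have P0 : 0 <= 252 * x ^+ 6 * k%:R :> R.
    by rewrite !mulr_ge0 // exprn_ge0.
  by rewrite ler_peMr // ler_pdivlMr // mul1r.
have [k1 conn1 inj1 dis1] := pos_outlier_embedding e_sym conn ast dens posP Zk.
split=> //; apply: le_trans dis1 _; rewrite -natrM.
(* 924 is 2 times 42 times 11: the scale is at most [42 C^2] and [10 C + 1 <= 11 C]. Replacing [C]
   by [2 c] multiplies by 8 and gives 7392. *)
apply: (@le_trans _ _ ((924 * C ^ 3)%N%:R)).
  rewrite ler_nat.
  have M1 : (minn (2 * (2 * C * (10 * C)).+1) n <= 42 * C ^ 2)%N.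
    by apply: leq_trans (geq_minl _ _) _; move: C_gt0; clear; nia.
  have C11 : ((10 * C).+1 <= 11 * C)%N by move: C_gt0; clear; lia.
  apply: leq_trans (leq_mul (leq_mul (leqnn 2) M1) C11) _.
  by rewrite [(C ^ 3)%N]expnSr; move: (C ^ 2)%N; clear; nia.
rewrite natrM natrX.
apply: (@le_trans _ _ (924 * (2 * x) ^+ 3)).
  apply: ler_wpM2l; first exact: ler0n.
  by rewrite ler_pXn2r // nnegrE ?ler0n // mulr_ge0.
have -> : 924 * (2 * x) ^+ 3 = 7392 * x ^+ 3 :> R by ring.
by apply: ler_wpM2l; [exact: ler0n|exact: ler_weXn2l].
Qed.
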